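(* Let $n\ge1$ be an integer. Then the system \[ \mathcal R_n=\{1\}\cup\{\sqrt3\,\mathcal C_{\mathbf k},\ \sqrt3\,\mathcal S_{\mathbf k}:\mathbf k\in\mathbb Z^n,\ \mathbf k\succ0\} \] is a Riesz basis of the real Hilbert space $L_2((0,1)^n)$ with Riesz constants \[ A=\left\{\frac{4\sqrt6}{\pi^2}\left(2-\frac{\pi^2}{8}\right)\right\}^2=0.5787\dots\qquad\text{and}\qquad B=\frac32 . \]
   Context: Define $\mathcal C(x)=4\left|x-\frac12\right|-1$ and $\mathcal S(x)=\left|2-4\left|x-\frac14\right|\right|-1$ for $x\in[0,1]$, and extend both functions to $\mathbb R$ periodically with period $1$. For $\mathbf k\in\mathbb Z^n\setminus\{0\}$ we write $\mathbf k\succ 0$ if the first non-zero entry of $\mathbf k$ is positive, and put $\mathcal C_{\mathbf k}(x)=\mathcal C(\mathbf k\cdot x)$, $\mathcal S_{\mathbf k}(x)=\mathcal S(\mathbf k\cdot x)$ for $x\in\mathbb R^n$, where $\mathbf k\cdot x=k_1x_1+\dots+k_nx_n$. A countable family $(\varphi_j)_{j\in J}$ in a Hilbert space $H$ is a Riesz basis with Riesz constants $0<A\le B<\infty$ if $A\sum_{j}\alpha_j^2\le\left\|\sum_{j}\alpha_j\varphi_j\right\|^2\le B\sum_j\alpha_j^2$ for every square-summable real family $(\alpha_j)_{j\in J}$, and the closed linear span of $(\varphi_j)_{j\in J}$ is $H$. (The Riesz constants are not required to be optimal.) *)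

(* Defs.v *)
From HB Require Import structures.
From mathcomp Require Import all_boot all_order all_algebra finmap.
From mathcomp Require Import lra.
From mathcomp Require Import all_classical all_reals all_analysis.
From mathcomp Require Import measurable_realfun.

Set Implicit Arguments.
Unset Strict Implicit.
Unset Printing Implicit Defensive.

Import Order.TTheory GRing.Theory Num.Theory.
Import numFieldNormedType.Exports.

Local Open Scope classical_set_scope.
Local Open Scope ring_scope.

Section lebesgue_cons.
Variables (R : realType) (n : nat).
Variable mu : {sigma_finite_measure set (n.-tuple (measurableTypeR R)) -> \bar R}.

Definition tuple_cons (p : measurableTypeR R * n.-tuple (measurableTypeR R)) :
    n.+1.-tuple (measurableTypeR R) :=
  [the n.+1.-tuple _ of p.1 :: p.2].

Lemma measurable_tuple_cons : measurable_fun setT tuple_cons.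
Proof. exact: measurable_cons. Qed.

Definition lebesgue_cons : set (n.+1.-tuple (measurableTypeR R)) -> \bar R :=
  pushforward (lebesgue_measure \x mu)%E tuple_cons.

Let lc_measure : {measure set (n.+1.-tuple (measurableTypeR R)) -> \bar R} :=
  measure_function_pushforward__canonical__measure_function_Measure
    (lebesgue_measure \x mu)%E measurable_tuple_cons.

HB.instance Definition _ := isMeasure.Build _ _ _ lebesgue_cons
  (@measure0 _ _ _ lc_measure) (@measure_ge0 _ _ _ lc_measure)
  (@measure_semi_sigma_additive _ _ _ lc_measure).

Let lebesgue_cons_sigma_finite : sigma_finite setT lebesgue_cons.
Proof.
have /sigma_finiteP[F [UF ndF Foo]] := sigma_finiteT (@lebesgue_measure R).
have /sigma_finiteP[G [UG ndG Goo]] := sigma_finiteT mu.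
pose uncons (t : n.+1.-tuple (measurableTypeR R)) :=
  (thead t, [tuple of behead t] : n.-tuple (measurableTypeR R)).
have muncons : measurable_fun setT uncons.
  apply/measurable_fun_pair; first exact: measurable_tnth.
  exact: measurable_behead.
have consK p : uncons (tuple_cons p) = p.
  by case: p => x t; congr pair; exact: val_inj.
exists (fun i => uncons @^-1` (F i `*` G i)).
  rewrite -preimage_bigcup (_ : \bigcup_i _ = setT) ?preimage_setT//.
  apply/seteqP; split => // -[x y] _.
  have [k _ Fx] : (\bigcup_i F i) x by rewrite -UF.
  have [l _ Gy] : (\bigcup_i G i) y by rewrite -UG.
  exists (maxn k l) => //; split.
  - by move: x Fx; exact/subsetPset/ndF/leq_maxl.
  - by move: y Gy; exact/subsetPset/ndG/leq_maxr.
move=> i; have [mF Fi] := Foo i; have [mG Gi] := Goo i; split.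
  by rewrite -[X in measurable X]setTI; apply: muncons => //; exact: measurableX.
rewrite /lebesgue_cons /pushforward -comp_preimage.
rewrite (_ : uncons \o tuple_cons = id) ?preimage_id; last exact/funext.
by rewrite product_measure1E// lte_mul_pinfty// ge0_fin_numE.
Qed.

HB.instance Definition _ := Measure_isSigmaFinite.Build _ _ _ lebesgue_cons
  lebesgue_cons_sigma_finite.

End lebesgue_cons.

(* Lebesgue measure on R^n, where R^n is the type of n-tuples with the product
   sigma-algebra: R^(n+1) is identified with R * R^n and given the product
   measure. lebesgue_tuple_box gives its value on boxes. *)
Fixpoint lebesgue_tuple (R : realType) (n : nat) :
    {sigma_finite_measure set (n.-tuple (measurableTypeR R)) -> \bar R} :=
  match n with
  | 0 => \d_ ([tuple] : 0.-tuple (measurableTypeR R))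
  | m.+1 => lebesgue_cons (lebesgue_tuple R m)
  end.

Section unit_cube.
Variable R : realType.
Local Notation RT := (measurableTypeR R).

Lemma measurable_box n (A : 'I_n -> set RT) :
  (forall i, measurable (A i)) ->
  measurable [set t : n.-tuple RT | forall i, A i (tnth t i)].
Proof.
move=> mA.
rewrite (_ : [set _ | _] = \bigcap_(i in [set: 'I_n]) ((@tnth _ RT ^~ i) @^-1` A i)).
  apply: fin_bigcap_measurable => // i _.
  by rewrite -[X in measurable X]setTI; exact: measurable_tnth.
by apply/seteqP; split => t /= At i; [move=> _; exact: At|exact: At].
Qed.

Lemma lebesgue_tuple_box n (A : 'I_n -> set RT) :
  (forall i, measurable (A i)) ->
  lebesgue_tuple R n [set t | forall i, A i (tnth t i)] =
  (\prod_(i < n) lebesgue_measure (A i))%E.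
Proof.
elim: n => [|n IHn] in A *.
  move=> _; rewrite big_ord0 /= diracE mem_set//.
  by case.
move=> mA; rewrite big_ord_recl -IHn; last by move=> i; exact: mA.
have mB := measurable_box (fun i : 'I_n => mA (lift ord0 i)).
rewrite /= /lebesgue_cons /pushforward -(product_measure1E _ _ (mA ord0) mB).
congr ((_ \x _)%E _); apply/seteqP; split => -[x t] /=.
  move=> At; split => [|i]; first by have := At ord0.
  by have := At (lift ord0 i); rewrite tnthS.
move=> [Ax At] i; case: (unliftP ord0 i) => [j ->|->//].
by rewrite tnthS; exact: At.
Qed.

Definition unit_cube n : set (n.-tuple RT) :=
  [set t | forall i, 0 < tnth t i < 1].
Arguments unit_cube : clear implicits.

Let unit_cubeE n : unit_cube n =
  [set t : n.-tuple RT | forall i, `]0, 1[%classic (tnth t i)].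
Proof. by apply/seteqP; split => t /= h i; have := h i; rewrite in_itv. Qed.

Lemma measurable_unit_cube n : measurable (unit_cube n).
Proof.
by rewrite unit_cubeE; apply: (@measurable_box n (fun=> `]0, 1[%classic)).
Qed.

Lemma lebesgue_unit_cube n : lebesgue_tuple R n (unit_cube n) = 1%E.
Proof.
rewrite unit_cubeE (@lebesgue_tuple_box n (fun=> `]0, 1[%classic))// big1// => i _.
by rewrite lebesgue_measure_itv/= lte_fin ltr01 oppr0 adde0.
Qed.

(* Lebesgue measure on the open unit cube, extended by 0 to the rest of R^n. *)
Definition cube_measure n : {measure set (n.-tuple RT) -> \bar R} :=
  mrestr (lebesgue_tuple R n) (@measurable_unit_cube n).

Lemma cube_measureT n : cube_measure n setT = 1%E.
Proof. by rewrite /cube_measure /= /mrestr setTI lebesgue_unit_cube. Qed.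

End unit_cube.

(* Elements are square-integrable functions rather than classes modulo equality
   almost everywhere; L2norm below is the corresponding seminorm, and the
   notions stated with it only depend on the classes. For cube_measure the
   values outside the cube are irrelevant. *)
Notation L2 mu := (LfunType mu (lee1n 2)).

Section riesz_basis.
Context d (T : measurableType d) (R : realType).
Variable mu : {measure set T -> \bar R}.

Definition L2norm (f : L2 mu) : R := fine 'N[mu]_2%:E[EFin \o f].

(* Unconditional sum: limit of the net of finite partial sums. *)
Definition L2_has_sum (J : choiceType) (u : J -> L2 mu) (s : L2 mu) : Prop :=
  forall eps : R, 0 < eps -> exists F0 : {fset J}, forall F : {fset J},
    (F0 `<=` F)%fset -> L2norm (s - \sum_(j <- F) u j) < eps.

(* S is the possibly infinite sum of the alpha_j ^ 2; convergence of the
   series with coefficients alpha is part of the claim. *)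
Definition riesz_basis (J : countType) (phi : J -> L2 mu) (A B : R) : Prop :=
  [/\ 0 < A /\ A <= B,
      forall alpha : J -> R,
        let S := (\esum_(j in [set: J]) (alpha j ^+ 2)%:E)%E in
        (S < +oo)%E ->
        exists s : L2 mu,
          L2_has_sum (fun j => alpha j *: phi j) s /\
          (A%:E * S <= (L2norm s ^+ 2)%:E <= B%:E * S)%E &
      forall (f : L2 mu) (eps : R), 0 < eps ->
        exists (F : {fset J}) (alpha : J -> R),
          L2norm (f - \sum_(j <- F) alpha j *: phi j) < eps].

End riesz_basis.
Arguments riesz_basis {d T R} mu {J} phi A B.

Section triangular_waves.
Variable R : realType.

(* Only the values of f on [0, 1[ matter; the two functions below take equal
   values at 0 and 1. *)
Definition periodize (f : R -> R) (x : R) : R := f (x - (Num.floor x)%:~R).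

Definition tri_cos : R -> R := periodize (fun x => 4 * `|x - 1 / 2| - 1).

Definition tri_sin : R -> R :=
  periodize (fun x => `|2 - 4 * `|x - 1 / 4| | - 1).

(* The first non-zero entry of k exists and is positive. *)
Definition lex_pos n (k : n.-tuple int) : bool :=
  [exists i : 'I_n, (0 < tnth k i) &&
    [forall j : 'I_n, (j < i)%N ==> (tnth k j == 0)]].

Definition freq n : Type := {k : n.-tuple int | lex_pos k}.

Definition dotz n (k : n.-tuple int) (x : n.-tuple (measurableTypeR R)) : R :=
  \sum_(i < n) (tnth k i)%:~R * tnth x i.

Definition Rsys_fun n (j : option (freq n + freq n))
    (x : n.-tuple (measurableTypeR R)) : R :=
  match j with
  | None => 1
  | Some (inl k) => Num.sqrt 3 * tri_cos (dotz (val k) x)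
  | Some (inr k) => Num.sqrt 3 * tri_sin (dotz (val k) x)
  end.

Lemma measurable_floor :
  measurable_fun [set: R] (fun x : R => (Num.floor x)%:~R : R).
Proof.
apply: nondecreasing_measurable => // x y xy.
by rewrite ler_int le_floor.
Qed.

Lemma measurable_periodize f : measurable_fun [set: R] f ->
  measurable_fun [set: R] (periodize f).
Proof.
move=> mf; apply: (measurableT_comp mf).
by apply: measurable_funB => //; exact: measurable_floor.
Qed.

Lemma measurable_tri_cos : measurable_fun [set: R] tri_cos.
Proof.
apply: measurable_periodize; apply: measurable_funB => //.
apply: measurable_funM => //; apply: measurableT_comp => //.
exact: measurable_funB.
Qed.

Lemma measurable_tri_sin : measurable_fun [set: R] tri_sin.
Proof.
apply: measurable_periodize; apply: measurable_funB => //.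
apply: measurableT_comp => //; apply: measurable_funB => //.
apply: measurable_funM => //; apply: measurableT_comp => //.
exact: measurable_funB.
Qed.

Lemma measurable_dotz n (k : n.-tuple int) : measurable_fun setT (dotz k).
Proof.
apply: measurable_sum => i; apply: measurable_funM => //.
exact: measurable_tnth.
Qed.

Lemma measurable_Rsys_fun n (j : option (freq n + freq n)) :
  measurable_fun setT (Rsys_fun j).
Proof.
case: j => [[k|k]|] /=; last exact: measurable_cst.
- apply: measurable_funM => //.
  exact: (measurableT_comp measurable_tri_cos (measurable_dotz _)).
- apply: measurable_funM => //.
  exact: (measurableT_comp measurable_tri_sin (measurable_dotz _)).
Qed.

Lemma fracpart_itv (x : R) : 0 <= x - (Num.floor x)%:~R < 1.
Proof.
have /andP[h1 h2] := floor_itv x.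
by rewrite subr_ge0 h1/= ltrBlDl -[1](mulr1z 1) -intrD.
Qed.

Lemma tri_cos_le1 (x : R) : `|tri_cos x| <= 1.
Proof.
rewrite /tri_cos /periodize; move: (fracpart_itv x); set y := (x - _).
move=> /andP[y0 y1]; rewrite ler_norml.
by case: (ger0P (y - 1 / 2)) => h; apply/andP; split; lra.
Qed.

Lemma tri_sin_le1 (x : R) : `|tri_sin x| <= 1.
Proof.
rewrite /tri_sin /periodize; move: (fracpart_itv x); set y := (x - _).
move=> /andP[y0 y1]; rewrite ler_norml.
case: (ger0P (y - 1 / 4)) => h.
  by case: (ger0P (2 - 4 * (y - 1 / 4))) => h'; apply/andP; split; lra.
by case: (ger0P (2 - 4 * - (y - 1 / 4))) => h'; apply/andP; split; lra.
Qed.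

Lemma Rsys_fun_bounded n (j : option (freq n + freq n)) x :
  `|Rsys_fun j x| <= Num.sqrt 3.
Proof.
case: j => [[k|k]|] /=.
- by rewrite normrM ger0_norm// ler_piMr// tri_cos_le1.
- by rewrite normrM ger0_norm// ler_piMr// tri_sin_le1.
- by rewrite normr1 -[leLHS](@sqrtr1 R) ler_wsqrtr// ler1n.
Qed.

Lemma Rsys_fun_Lfun n (j : option (freq n + freq n)) :
  Rsys_fun j \in Lfun (cube_measure R n) 2%:E.
Proof.
rewrite inE; apply/andP; split; rewrite inE/=.
  exact: measurable_Rsys_fun.
rewrite /finite_norm unlock poweR_lty//.
apply: (@le_lt_trans _ _ (\int[cube_measure R n]_x (cst (Num.sqrt 3 `^ 2)%:E x))%E).
  apply: ge0_le_integral => //=.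
  - apply/measurable_EFinP.
    apply: (measurableT_comp (measurable_powR _)).
    apply: measurableT_comp => //; exact: measurable_Rsys_fun.
  - by move=> x _; rewrite lee_fin ge0_ler_powR// ?nnegrE// Rsys_fun_bounded.
by rewrite integral_cst// [X in (_ * X)%E]cube_measureT mule1 ltry.
Qed.

End triangular_waves.

Definition Rsys (R : realType) (n : nat) (j : option (freq n + freq n)) :
    L2 (cube_measure R n) :=
  Lfun_Sub (lee1n 2) (Rsys_fun_Lfun R j).
Arguments Rsys : clear implicits.

(* Main.v *)
(** The trigonometric system [e_k] is orthonormal, and the Fourier expansion of
    the triangular wave, [C x = 8/pi^2 * \sum_(m odd) cos (2 pi m x) / m^2],
    writes each element of the system as [phi_k = c * \sum_(m odd) m^-2 e_(mk)],
    up to signs, with [c = 4 sqrt 6 / pi^2].  For fixed [m] the map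
    [e_k |-> e_(mk)] is an isometry, and [\sum_(m odd, m > 1) m^-2 = q] with
    [q = pi^2/8 - 1 < 1], so the triangle inequality bounds the synthesis operator
    between [c (1 - q)] and [c (1 + q) = sqrt (3/2)].

    The expansion is obtained by integrating twice the Dirichlet kernel
    [\sum_(i < M) cos ((2i+1) y) = sin (2 M y) / (2 sin y)]; Leibniz' series gives
    the slope of the limit.  Density: the distances of the [e_k] to the closed
    span are at most [q] times their supremum, hence [0], so the closed span
    contains all trigonometric functions.  Its bounded elements then form an
    algebra, so the sets with indicator function in it form a sigma-algebra.  This
    contains the half-spaces [x_i > a], because the difference quotients of the
    translated triangular waves converge to square waves. *)
Require Import Defs.
From HB Require Import structures.
From mathcomp Require Import all_boot all_order all_algebra finmap.
From mathcomp Require Import ring lra zify.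
From mathcomp Require Import all_classical all_reals all_analysis.
From mathcomp Require Import measurable_realfun.

Set Implicit Arguments.
Unset Strict Implicit.
Unset Printing Implicit Defensive.

Import Order.TTheory GRing.Theory Num.Theory.
Import numFieldNormedType.Exports.

Local Open Scope classical_set_scope.
Local Open Scope ring_scope.

(** * Fourier expansion of the triangular wave *)

Section calculus.
Variable R : realType.
Implicit Types x y t : R.

(** Origin of the constants: an element of the system has leading Fourier coefficient
    [sqrt 3 * 8 / pi^2], and dividing by the factor [sqrt 2] that makes the cosines unit vectors
    gives [c]. The expansion at [0] sums the inverse odd squares to [pi^2/8]. Hence
    [1 - q = 2 - pi^2/8], which yields [A], while in [c * (1 + q)] the powers of [pi] cancel, which
    yields [B]. The constant function does not have an expansion with leading coefficient [c]. It is
    fitted into the pattern by artificial higher harmonics [lam * 1], with one [lam] in [[0, 1]]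
    that exists because [c <= 1 <= c * (1 + q)]. On the whole system the maps for [m > 1] are then
    contractions, which is what the triangle inequality asks for. The obstacle in the expansion is
    uniformity: the error constant obtained from the Dirichlet kernel blows up as [sin y] tends to
    [0]. The kernel therefore only identifies the limit at each fixed [y > 0]; the rate comes from
    the absolutely convergent tail, which is uniform in [y]. *)

Lemma norm_le_derive (f g f' g' : R -> R) (a b : R) : a <= b ->
  (forall x, a <= x <= b -> is_derive x 1 f (f' x)) ->
  (forall x, a <= x <= b -> is_derive x 1 g (g' x)) ->
  (forall x, a <= x <= b -> `|f' x| <= g' x) ->
  `|f b - f a| <= g b - g a.
Proof.
move=> ab df dg fg.
have key (u u' : R -> R) : (forall x, a <= x <= b -> is_derive x 1 u (u' x)) ->
    (forall x, a <= x <= b -> 0 <= u' x) -> u a <= u b.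
  move=> du u0.
  have sub x : x \in `]a, b[ -> a <= x <= b.
    by rewrite in_itv/= => /andP[/ltW-> /ltW->].
  have [|x /[!in_itv]/= xab e] := @MVT_segment R u u' _ _ ab
      (fun x xab => du x (sub x xab)).
    apply: derivable_within_continuous => x; rewrite in_itv/= => /du h.
    by case: h.
  by rewrite -subr_ge0 e mulr_ge0// ?u0// subr_ge0.
(* Since [|f'| <= g'], both [g - f] and [g + f] have a nonnegative derivative; they give the two
   sides of the estimate. *)
have h1 : (g - f) a <= (g - f) b.
  apply: (key _ (fun x => g' x - f' x)) => x xab.
    by apply: is_deriveB; [exact: dg|exact: df].
  by rewrite subr_ge0 (le_trans (ler_norm _) (fg _ xab)).
have h2 : (g + f) a <= (g + f) b.
  apply: (key _ (fun x => g' x + f' x)) => x xab.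
    by apply: is_deriveD; [exact: dg|exact: df].
  by have := fg _ xab; rewrite ler_norml => /andP[? _]; lra.
have e1 x : (g - f) x = g x - f x by [].
have e2 x : (g + f) x = g x + f x by [].
by rewrite !e1 in h1; rewrite !e2 in h2; rewrite ler_norml; apply/andP; split; lra.
Qed.

Lemma is_derive_fsum n (h : 'I_n -> R -> R) (dh : 'I_n -> R) x :
  (forall i, is_derive x 1 (h i) (dh i)) ->
  is_derive x 1 (fun t => \sum_(i < n) h i t) (\sum_(i < n) dh i).
Proof.
move=> dhi; rewrite (_ : (fun t => _) = \sum_(i < n) h i); last first.
  by apply/funext => t; rewrite fct_sumE.
exact: is_derive_sum.
Qed.

Lemma is_derive_cstM (f : R -> R) c x df : is_derive x 1 f df ->
  is_derive x 1 (fun t => c * f t) (c * df).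
Proof. by move=> fdf; apply: (is_deriveZ c fdf). Qed.

Lemma is_derive_monomial n x :
  is_derive x 1 (fun t => t ^+ n.+1 / n.+1%:R) (x ^+ n).
Proof.
have -> : (fun t : R => t ^+ n.+1 / n.+1%:R) = n.+1%:R^-1 \*: (id ^+ n.+1).
  by apply/funext => t /=; rewrite mulrC -[RHS]/(_ * _) exprfctE.
apply: is_derive_eq.
by rewrite /GRing.scale/= mulr1 mulrA mulVf ?mul1r// pnatr_eq0.
Qed.

(** By summing a geometric progression, the remainder has derivative [(-1)^M x^(2M) / (1 + x^2)],
    which is dominated by [x^(2M)]. The case [t = 1] is Leibniz' series; small [t] serve the
    numerical bounds for [pi]. *)
Lemma atan_sum_bound M t : 0 <= t ->
  `|atan t - \sum_(i < M) (-1) ^+ i * (t ^+ (i.*2).+1 / (i.*2).+1%:R)| <=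
  t ^+ (M.*2).+1 / (M.*2).+1%:R.
Proof.
move=> t0.
pose f t := atan t - \sum_(i < M) (-1) ^+ i * (t ^+ (i.*2).+1 / (i.*2).+1%:R).
have : `|f t - f 0| <= t ^+ (M.*2).+1 / (M.*2).+1%:R - 0 ^+ (M.*2).+1 / (M.*2).+1%:R.
  apply: (@norm_le_derive f (fun x => x ^+ (M.*2).+1 / (M.*2).+1%:R) (fun x => (1 + x ^+ 2)^-1 -
     \sum_(i < M) (-1) ^+ i * x ^+ i.*2) (fun x => x ^+ M.*2)) => // x x0.
  - apply: is_deriveB; apply: is_derive_fsum => i.
    exact/is_derive_cstM/is_derive_monomial.
  - exact: is_derive_monomial.
  - have p0 : 0 < 1 + x ^+ 2 by rewrite ltr_wpDr ?sqr_ge0.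
    suff -> : (1 + x ^+ 2)^-1 - \sum_(i < M) (-1) ^+ i * x ^+ i.*2 =
        (-1) ^+ M * x ^+ M.*2 / (1 + x ^+ 2).
      rewrite !normrM normrX normrN1 expr1n mul1r normfV (gtr0_norm p0).
      rewrite ger0_norm ?exprn_even_ge0 ?odd_double//.
      by rewrite ler_piMr ?exprn_even_ge0 ?odd_double// invf_le1// lerDl sqr_ge0.
    elim: M {f} => [|M IH]; first by rewrite big_ord0 subr0 mul1r expr0 mul1r.
    rewrite big_ord_recr/= opprD addrA IH doubleS !exprS.
    by field; rewrite gt_eqF.
have f0 : f 0 = 0.
  by rewrite /f atan0 big1 ?subr0// => i _; rewrite expr0n/= mul0r mulr0.
by rewrite f0 subr0 expr0n/= mul0r subr0.
Qed.

(** Telescoping: [sin y * cos ((2i+1) y)] is half the difference of [sin ((2i+2) y)] and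
    [sin (2i y)]. *)
Lemma cos_odd_sum M y :
  sin y * \sum_(i < M) cos ((i.*2).+1%:R * y) = sin ((M.*2)%:R * y) / 2.
Proof.
elim: M => [|M IH]; first by rewrite big_ord0 mul0r sin0 mulr0 mul0r.
rewrite big_ord_recr/= mulrDr IH doubleS.
have -> : (M.*2).+2%:R * y = (M.*2).+1%:R * y + y by rewrite -addn1 natrD; ring.
have -> : (M.*2)%:R * y = (M.*2).+1%:R * y - y by rewrite -[(M.*2).+1]addn1 natrD; ring.
by rewrite sinB sinD; field.
Qed.

Lemma sin_odd_pihalf i : sin ((i.*2).+1%:R * (pi / 2)) = (-1) ^+ i :> R.
Proof.
elim: i => [|i IH]; first by rewrite mul1r sin_pihalf.
have -> : (i.+1.*2).+1%:R * (pi / 2) = (i.*2).+1%:R * (pi / 2) + pi :> R.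
  by rewrite doubleS -addn2 natrD; field.
by rewrite sinDpi IH exprS mulN1r.
Qed.

Lemma cos_odd_pihalf i : cos ((i.*2).+1%:R * (pi / 2)) = 0 :> R.
Proof.
elim: i => [|i IH]; first by rewrite mul1r cos_pihalf.
have -> : (i.+1.*2).+1%:R * (pi / 2) = (i.*2).+1%:R * (pi / 2) + pi :> R.
  by rewrite doubleS -addn2 natrD; field.
by rewrite cosDpi IH oppr0.
Qed.

Lemma is_derive_cosM k x : is_derive x 1 (fun t => cos (k * t)) (- (k * sin (k * x))).
Proof.
rewrite (_ : (fun t => _) = cos \o (k \*: id)); last exact/funext.
apply: is_derive_eq.
by rewrite /GRing.scale/= mulr1; ring.
Qed.

Lemma is_derive_sinM k x : is_derive x 1 (fun t => sin (k * t)) (k * cos (k * x)).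
Proof.
rewrite (_ : (fun t => _) = sin \o (k \*: id)); last exact/funext.
apply: is_derive_eq.
by rewrite /GRing.scale/= mulr1; ring.
Qed.

(** On [[0, pi]] the limit is the linear function [pi/4 * (pi/2 - y)], up to scaling one slope of
    the triangular wave. *)
Definition cos_partial M y := \sum_(i < M) cos ((i.*2).+1%:R * y) / (i.*2).+1%:R ^+ 2.

Lemma is_derive_cos_partial M x : is_derive x 1 (cos_partial M)
  (- \sum_(i < M) sin ((i.*2).+1%:R * x) / (i.*2).+1%:R).
Proof.
rewrite -sumrN; apply: is_derive_fsum => i.
have -> : (fun t => cos ((i.*2).+1%:R * t) / (i.*2).+1%:R ^+ 2) =
  (i.*2).+1%:R ^- 2 \*: (fun t => cos ((i.*2).+1%:R * t)).
  by apply/funext => t; rewrite mulrC.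
have h := is_derive_cstM ((i.*2).+1%:R ^- 2) (is_derive_cosM (i.*2).+1%:R x).
apply: (is_derive_eq h).
by field; rewrite addrC natr1 pnatr_eq0.
Qed.

End calculus.

(** * The limit of the cosine series and its uniform rate *)

Section triangle_series.
Variable R : realType.
Implicit Types x y t : R.

(** All frequencies are odd, so the reflection at [pi/2] changes every sign; this carries estimates
    from [[0, pi/2]] over to [[0, pi]]. *)
Lemma cos_partial_sub M y : cos_partial M (pi - y) = - cos_partial M y.
Proof.
rewrite /cos_partial -sumrN; apply: eq_bigr => i _.
rewrite mulrBr (_ : _ * pi = (i.*2).+1%:R * (pi / 2) + (i.*2).+1%:R * (pi / 2)); last by field.
rewrite cosB cosD sinD cos_odd_pihalf sin_odd_pihalf.
have : (-1) ^+ i * (-1) ^+ i = 1 :> R by rewrite -expr2 -exprM mulnC exprM sqrrN !expr1n.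
by move=> ->; ring.
Qed.

Lemma leibniz_bound M :
  `|pi / 4 - \sum_(i < M) (-1) ^+ i / (i.*2).+1%:R| <= (M.*2).+1%:R^-1 :> R.
Proof.
have := @atan_sum_bound R M 1 ler01; rewrite atan1 expr1n mul1r.
by under eq_bigr do rewrite expr1n mul1r.
Qed.

(** The Dirichlet kernel is integrated twice, from [pi/2] down to [y]. The constant depends on [y]
    through [sin y], hence [0 < y]. *)
Lemma triangle_pointwise y : 0 < y <= pi / 2 -> exists C, forall M, (0 < M)%N ->
  `|cos_partial M y - pi / 4 * (pi / 2 - y)| <= C / M%:R.
Proof.
move=> /andP[y0 yp]; have pi0 : 0 < pi :> R := pi_gt0 R.
have s0 : 0 < sin y by apply: sin_gt0_pi; rewrite y0/=; lra.
have smono x : y <= x <= pi / 2 -> sin y <= sin x.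
  move=> /andP[yx xp].
  have : `|(fun=> 0 : R) x - (fun=> 0 : R) y| <= sin x - sin y.
    apply: (@norm_le_derive R (fun=> 0) sin (fun=> 0) cos y x yx) => t /andP[yt tx].
    by rewrite normr0 cos_ge0_pihalf//; apply/andP; split; lra.
  by rewrite /= subrr normr0 subr_ge0.
pose s := sin y.
(* The three terms bound, in turn, the integral that remains after integration by parts and the
   boundary terms at [pi/2] and at [x]; [s] is the least value of the sine on [[y, pi/2]]. *)
pose C1 := (pi / 2) / (4 * s ^+ 2) + 1 / 4 + 1 / (4 * s).
(* One term for the second integration, over an interval shorter than [pi/2], and one for replacing
   the truncated Leibniz sum [K] by [pi/4]. *)
exists (C1 * (pi / 2) + pi / 2) => M M0.
have m0 : 0 < M%:R :> R by rewrite ltr0n.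
pose K : R := \sum_(i < M) (-1) ^+ i / (i.*2).+1%:R.
pose m : R := M%:R.
have M2 : (M.*2)%:R = 2 * m by rewrite -muln2 natrM mulrC.
(* This is the derivative of [cos_partial M x - K * (pi/2 - x)]. Truncating Leibniz' series at the
   same [M] makes it vanish exactly at [pi/2]. *)
pose dE x := K - \sum_(i < M) sin ((i.*2).+1%:R * x) / (i.*2).+1%:R.
have dE0 : dE (pi / 2) = 0.
  rewrite /dE; apply/eqP; rewrite subr_eq0; apply/eqP/eq_bigr => i _.
  by rewrite sin_odd_pihalf.
have ddE x : is_derive x 1 dE (- \sum_(i < M) cos ((i.*2).+1%:R * x)).
  rewrite -[X in is_derive _ _ _ X]add0r; apply: is_deriveB.
  apply: is_derive_fsum => i.
  have := is_derive_cstM (i.*2).+1%:R^-1 (is_derive_sinM (i.*2).+1%:R x).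
  rewrite mulrA mulVf ?mul1r ?pnatr_eq0//.
  by congr (is_derive _ _ _ _); apply/funext => t; rewrite mulrC.
(* Integration by parts of the kernel [sin (2mx) / (2 sin x)]: subtracting the boundary function
   [cos (2mx) / (4m sin x)] leaves a derivative of order [1/m]. *)
have dP x : y <= x <= pi / 2 ->
    is_derive x 1 (fun x => dE x - (cos (2 * m * x) / sin x) / (4 * m))
      (cos (2 * m * x) * cos x / (4 * m * sin x ^+ 2)).
  move=> /[dup] yx /smono sx.
  have sx0 : sin x != 0 by rewrite gt_eqF// (lt_le_trans s0).
  have dV := is_deriveV sx0 (is_derive_sin x).
  have dM := is_deriveM (is_derive_cosM (2 * m) x) dV.
  have dZ := is_derive_cstM (4 * m)^-1 dM.
  have := is_deriveB (ddE x) dZ.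
  rewrite (_ : dE - _ = (fun x => dE x - (cos (2 * m * x) / sin x) / (4 * m))); last first.
    by apply/funext => t; rewrite [(4 * m)^-1]lock -[LHS]/(dE t - _ * (cos (2 * m * t) * (sin t)^-1)) -lock mulrC.
  move=> h; apply: (is_derive_eq h).
  have e : \sum_(i < M) cos ((i.*2).+1%:R * x) = sin (2 * m * x) / (2 * sin x).
    apply: (mulfI sx0); rewrite cos_odd_sum M2; by field.
  rewrite e /GRing.scale/=; field; rewrite sx0/= gt_eqF//.
have Eb x : y <= x <= pi / 2 -> `|dE x| <= C1 / m.
  move=> /[dup] yxp /andP[yx xp].
  have h : `|(dE (pi / 2) - (cos (2 * m * (pi / 2)) / sin (pi / 2)) / (4 * m)) -
       (dE x - (cos (2 * m * x) / sin x) / (4 * m))| <=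
      (4 * m * s ^+ 2)^-1 * (pi / 2) - (4 * m * s ^+ 2)^-1 * x.
    refine (@norm_le_derive R (fun x => dE x - (cos (2 * m * x) / sin x) / (4 * m))
      (fun t => (4 * m * s ^+ 2)^-1 * t)
      (fun x => cos (2 * m * x) * cos x / (4 * m * sin x ^+ 2))
      (fun=> (4 * m * s ^+ 2)^-1) x (pi / 2) xp _ _ _) => t /andP[xt tp].
    - by apply: dP; rewrite tp (le_trans yx).
    - by have := is_derive_cstM (4 * m * s ^+ 2)^-1 (is_derive_id t 1); rewrite mulr1.
    - have st : s <= sin t by apply: smono; rewrite tp (le_trans yx).
      have st0 : 0 < sin t := lt_le_trans s0 st.
      rewrite normrM normrM normfV (gtr0_norm (_ : 0 < 4 * m * sin t ^+ 2)); last first.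
        by rewrite mulr_gt0 ?mulr_gt0 ?exprn_gt0.
      rewrite -[leRHS]mul1r; apply: ler_pM.
      + by rewrite mulr_ge0.
      + by rewrite invr_ge0 !mulr_ge0 ?exprn_ge0// ltW.
      + by rewrite -[leRHS]mul1r ler_pM// cos_max.
      + rewrite lef_pV2 ?posrE ?mulr_gt0 ?exprn_gt0//.
        by rewrite ler_pM2l ?mulr_gt0// lerXn2r// nnegrE ltW.
  have sx0 : 0 < sin x by apply: (lt_le_trans s0); exact: smono.
  have h2 : `|cos (2 * m * x) / sin x / (4 * m)| <= 1 / (4 * s) / m.
    rewrite !normrM !normfV (gtr0_norm sx0) (gtr0_norm (_ : 0 < 4 * m)) ?mulr_gt0//.
    apply: (@le_trans _ _ (1 / s / (4 * m))).
      rewrite ler_pM2r ?invr_gt0 ?mulr_gt0// ler_pM ?invr_ge0 ?cos_max//; first exact: ltW.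
      by rewrite lef_pV2 ?posrE//; exact: smono.
    by rewrite le_eqVlt; apply/orP; left; apply/eqP; field; rewrite !gt_eqF.
  have h3 : `|cos (2 * m * (pi / 2)) / sin (pi / 2) / (4 * m)| <= 1 / 4 / m.
    rewrite sin_pihalf divr1 normrM normfV (gtr0_norm (_ : 0 < 4 * m)) ?mulr_gt0//.
    apply: (@le_trans _ _ (1 / (4 * m))).
      by rewrite ler_pM2r ?invr_gt0 ?mulr_gt0// cos_max.
    by rewrite le_eqVlt; apply/orP; left; apply/eqP; field; rewrite !gt_eqF.
  have h4 : (4 * m * s ^+ 2)^-1 * (pi / 2) - (4 * m * s ^+ 2)^-1 * x <= (pi / 2) / (4 * s ^+ 2) / m.
    rewrite (_ : (pi / 2) / (4 * s ^+ 2) / m = (4 * m * s ^+ 2)^-1 * (pi / 2)); last first.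
      by field; rewrite !gt_eqF.
    by rewrite gerBl mulr_ge0// ?invr_ge0 ?mulr_ge0 ?exprn_ge0// ltW// (lt_le_trans y0).
  rewrite /C1 [leRHS]mulrDl [X in X + _]mulrDl.
  move: h h2 h3; rewrite dE0.
  set a := _ / (4 * m); set b := _ / (4 * m).
  rewrite !ler_norml => /andP[? ?] /andP[? ?] /andP[? ?].
  by apply/andP; split; lra.
have h : `|(cos_partial M (pi / 2) - K * (pi / 2 - pi / 2)) -
      (cos_partial M y - K * (pi / 2 - y))| <= C1 / m * (pi / 2) - C1 / m * y.
  apply: (@norm_le_derive R (fun x => cos_partial M x - K * (pi / 2 - x))
      (fun t => C1 / m * t) dE (fun=> C1 / m)) => // x xp.
  - have := is_deriveB (is_derive_cos_partial M x)
      (is_derive_cstM K (is_deriveB (is_derive_cst (pi / 2) x 1) (is_derive_id x 1))).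
    by move=> /is_derive_eq; apply; rewrite /dE; ring.
  - by have := is_derive_cstM (C1 / m) (is_derive_id x 1); rewrite mulr1.
have c0 : cos_partial M (pi / 2) = 0 :> R.
  by rewrite /cos_partial big1// => i _; rewrite cos_odd_pihalf mul0r.
have C1y : 0 <= C1 / m * y.
  by rewrite !mulr_ge0// ?invr_ge0 ?addr_ge0 ?divr_ge0 ?mulr_ge0 ?exprn_ge0// ltW.
have lb : `|pi / 4 - K| * (pi / 2 - y) <= m^-1 * (pi / 2).
  rewrite ler_pM//; first by rewrite subr_ge0.
    apply: (le_trans (leibniz_bound M)).
    by rewrite lef_pV2 ?posrE// ler_nat -addnn; lia.
  by rewrite gerBl ltW.
rewrite -/m [leRHS]mulrDl.
have -> : cos_partial M y - pi / 4 * (pi / 2 - y) =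
  (cos_partial M y - K * (pi / 2 - y)) - (pi / 4 - K) * (pi / 2 - y) by ring.
apply: (le_trans (ler_normB _ _)); apply: lerD.
  move: h; rewrite c0 subrr mulr0 subr0 sub0r normrN => h.
  by apply: (le_trans h); rewrite [leRHS]mulrAC gerBl.
by rewrite normrM (ger0_norm (_ : 0 <= pi / 2 - y)) ?subr_ge0// mulrC in lb *; rewrite (mulrC (pi / 2)).
Qed.

(** Since [(2i+1)^2 > 4i(i+1)], each term is below [1/(4i) - 1/(4(i+1))], and the bound
    telescopes. *)
Lemma inv_odd_sq_sum_tail M N : (0 < M)%N -> (M <= N)%N ->
  \sum_(M <= i < N) (i.*2).+1%:R ^- 2 <= (4 * M%:R)^-1 :> R.
Proof.
move=> M0 MN.
suff : \sum_(M <= i < N) (i.*2).+1%:R ^- 2 <= (4 * M%:R)^-1 - (4 * N%:R)^-1 :> R.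
  by move/le_trans; apply; rewrite gerBl invr_ge0 mulr_ge0.
elim: N MN => [|N IH]; first by rewrite leqn0 => /eqP->; rewrite big_geq// subrr.
rewrite leq_eqVlt => /predU1P[->|]; first by rewrite big_geq// subrr.
rewrite ltnS => MN; rewrite big_nat_recr//=.
have N0 : 0 < N%:R :> R by rewrite ltr0n (leq_trans M0).
apply: (le_trans (lerD (IH MN) (lexx _))).
rewrite -addrA lerD2l -addn1 -muln2 -natr1 natrM natrD.
rewrite -subr_ge0 (_ : _ - _ = (4 * N%:R * (N%:R + 1) * (N%:R * 2 + 1) ^+ 2)^-1).
  by rewrite invr_ge0 !mulr_ge0 ?exprn_ge0 ?addr_ge0 ?mulr_ge0// ltW.
by field; rewrite !gt_eqF ?addr_gt0 ?mulr_gt0.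
Qed.

Lemma cos_partial_tail M N y : (0 < M)%N -> (M <= N)%N ->
  `|cos_partial N y - cos_partial M y| <= (4 * M%:R)^-1.
Proof.
move=> M0 MN; rewrite /cos_partial.
rewrite -(big_mkord xpredT (fun i => cos ((i.*2).+1%:R * y) / (i.*2).+1%:R ^+ 2)).
rewrite -(big_mkord xpredT (fun i => cos ((i.*2).+1%:R * y) / (i.*2).+1%:R ^+ 2)).
rewrite (big_cat_nat (n := M))//= addrAC subrr add0r.
apply: (le_trans (ler_norm_sum _ _ _)); apply: le_trans (inv_odd_sq_sum_tail M0 MN).
apply: ler_sum => i _; rewrite normrM normfV [X in _ / X]ger0_norm//.
by rewrite ler_piMl ?invr_ge0// cos_max.
Qed.

Lemma le_forall_divn (a b C : R) : (forall N, (0 < N)%N -> a <= b + C / N%:R) -> a <= b.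
Proof.
move=> h; apply/ler_addgt0Pr => e e0.
pose N := (Num.truncn (`|C| / e)).+1.
have := h N isT; move/le_trans; apply; rewrite lerD2l.
rewrite ler_pdivrMr ?ltr0n//; apply: (le_trans (ler_norm _)).
by rewrite mulrC -ler_pdivrMr// ltW// truncnS_gt.
Qed.

(** Compare with a later partial sum and let its length tend to infinity: the error that depends on
    [y] disappears, and the uniform tail bound remains. *)
Lemma triangle_expansion_pihalf M y : (0 < M)%N -> 0 < y <= pi / 2 ->
  `|cos_partial M y - pi / 4 * (pi / 2 - y)| <= (4 * M%:R)^-1.
Proof.
move=> M0 /triangle_pointwise[C hC]; apply: (@le_forall_divn _ _ `|C|) => N N0.
have MN : (M <= maxn M N)%N := leq_maxl _ _.
have h1 := cos_partial_tail y M0 MN.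
have h2 := hC _ (leq_trans M0 MN).
have -> : cos_partial M y - pi / 4 * (pi / 2 - y) = - (cos_partial (maxn M N) y - cos_partial M y)
   + (cos_partial (maxn M N) y - pi / 4 * (pi / 2 - y)) by ring.
apply: (le_trans (ler_normD _ _)); rewrite normrN lerD// (le_trans h2)//.
rewrite (le_trans (ler_wpM2r _ (ler_norm _))) ?invr_ge0//.
by rewrite ler_wpM2l// lef_pV2 ?posrE ?ltr0n ?(leq_trans M0 MN)// ler_nat leq_maxr.
Qed.

(** At [0] the sine vanishes, so this value is reached by continuity from [y = 1/N], [cos_partial M]
    being [M]-Lipschitz. It evaluates the sum of the inverse odd squares as [pi^2/8]. *)
Lemma triangle_expansion0 M : (0 < M)%N ->
  `|cos_partial M 0 - pi / 4 * (pi / 2)| <= (4 * M%:R)^-1 :> R.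
Proof.
move=> M0; apply: (@le_forall_divn _ _ (M%:R + pi / 4)) => N N0.
have pi2 := pi_ge2 R.
have n0 : 0 < N%:R^-1 :> R by rewrite invr_gt0 ltr0n.
have n1 : N%:R^-1 <= 1 :> R by rewrite invf_le1 ?ltr0n// ler1n.
have h1 := @triangle_expansion_pihalf M N%:R^-1 M0.
have {h1} := h1 _; rewrite n0/= => /(_ _)/wrap[|h1]; first lra.
have h2 : `|cos_partial M N%:R^-1 - cos_partial M 0| <= M%:R * N%:R^-1 - M%:R * 0 :> R.
  apply: (@norm_le_derive R _ (fun t => M%:R * t) _ (fun=> M%:R) _ _ (ltW n0)
     (fun x _ => is_derive_cos_partial M x)) => x _.
    by have := is_derive_cstM M%:R (is_derive_id x 1); rewrite mulr1.
  rewrite normrN; apply: (le_trans (ler_norm_sum _ _ _)).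
  have -> : M%:R = \sum_(i < M) (1 : R) by rewrite sumr_const card_ord.
  apply: ler_sum => i _.
  rewrite normrM normfV [X in _ / X]ger0_norm// ler_pdivrMr ?ltr0n// mul1r.
  by rewrite (le_trans (sin_max _))// ler1n.
rewrite mulr0 subr0 in h2.
move: h1 h2; rewrite [(_ + _) / N%:R]mulrDl !ler_norml.
have : 0 <= pi / 4 / N%:R :> R by rewrite !divr_ge0// ltW// pi_gt0.
by move=> ? /andP[? ?] /andP[? ?]; apply/andP; split; lra.
Qed.

Lemma triangle_expansion M y : (0 < M)%N -> 0 <= y <= pi ->
  `|cos_partial M y - pi / 4 * (pi / 2 - y)| <= (4 * M%:R)^-1.
Proof.
move=> M0 /andP[y0 yp]; have pi0 := pi_gt0 R.
have key z : 0 <= z <= pi / 2 ->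
    `|cos_partial M z - pi / 4 * (pi / 2 - z)| <= (4 * M%:R)^-1 :> R.
  move=> /andP[]; rewrite le_eqVlt => /predU1P[<- _|z0 z1].
    by rewrite subr0 triangle_expansion0.
  by rewrite triangle_expansion_pihalf// z0.
have [yh|yh] := leP y (pi / 2); first by rewrite key// y0.
have e : cos_partial M y - pi / 4 * (pi / 2 - y) =
    - (cos_partial M (pi - y) - pi / 4 * (pi / 2 - (pi - y))).
  rewrite cos_partial_sub; set c := cos_partial M y; by field.
by rewrite e normrN; apply: key; apply/andP; split; lra.
Qed.

Lemma cos_partialN M y : cos_partial M (- y) = cos_partial M y.
Proof. by apply: eq_bigr => i _; rewrite mulrN cosN. Qed.

Lemma cosDz (m : int) x : cos (x + m%:~R * (pi *+ 2)) = cos x.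
Proof.
case: m => m; first by rewrite -[_%:~R]/(m%:R) mulr_natl (periodicn (@cosD2pi R)).
rewrite NegzE mulrNz mulNr -[_%:~R]/(m.+1%:R) mulr_natl.
by rewrite -[LHS](periodicn (@cosD2pi R) m.+1) subrK.
Qed.

Lemma cos_partialDz M (m : int) y : cos_partial M (y + m%:~R * (pi *+ 2)) = cos_partial M y.
Proof.
apply: eq_bigr => i _; congr (_ / _).
rewrite -[RHS](cosDz ((i.*2).+1%:Z * m)); congr cos.
by rewrite intrM mulrDr mulrA.
Qed.

(** The range [[-1, 1]] serves both waves: [z] will be the fractional part for [tri_cos], and the
    fractional part minus [1/4] for [tri_sin]. Evenness and periodicity fold [z] back to [[0, 1/2]],
    where the wave is [1 - 4x]. *)
Lemma triangle_wave_expansion M (z : R) : (0 < M)%N -> -1 <= z <= 1 ->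
  `|(4 * `| `|z| - 1 / 2| - 1) - 8 / pi ^+ 2 * cos_partial M (z * (pi *+ 2))| <= M%:R^-1.
Proof.
move=> M0 /andP[z1 z2]; have pi2 := pi_ge2 R; have pi0 := pi_gt0 R.
have key x : 0 <= x <= 1 / 2 ->
  `|(1 - 4 * x) - 8 / pi ^+ 2 * cos_partial M (x * (pi *+ 2))| <= M%:R^-1.
  move=> /andP[x0 x1].
  have xp : 0 <= x * (pi *+ 2) <= pi.
    by rewrite -[pi *+ 2]mulr_natr; apply/andP; split; nra.
  have := triangle_expansion M0 xp; set c := cos_partial _ _ => h.
  have -> : 1 - 4 * x - 8 / pi ^+ 2 * c = - (8 / pi ^+ 2) * (c - pi / 4 * (pi / 2 - x * (pi *+ 2))).
    rewrite -[pi *+ 2]mulr_natr; have := lt0r_neq0 pi0; move: (pi) => p p0; by field.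
  rewrite normrM normrN [ `|8 / _| ]ger0_norm ?divr_ge0 ?exprn_ge0 ?(ltW pi0)//.
  have p4 : 4 <= pi ^+ 2 :> R by rewrite (_ : 4 = 2 ^+ 2) ?lerXn2r ?nnegrE// ?ltW//; ring.
  apply: (@le_trans _ _ (2 * (4 * M%:R)^-1)).
    apply: ler_pM => //; first by rewrite divr_ge0 ?exprn_ge0 ?(ltW pi0).
    by rewrite ler_pdivrMr ?exprn_gt0//; lra.
  rewrite invfM mulrA ler_piMl ?invr_ge0//; lra.
have [z0|z0] := leP 0 z.
  rewrite (ger0_norm z0); have [zh|zh] := leP z (1 / 2).
    have -> : `|z - 1 / 2| = 1 / 2 - z by rewrite distrC ger0_norm// subr_ge0.
    have -> : 4 * (1 / 2 - z) - 1 = 1 - 4 * z by field.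
    by apply: key; rewrite z0.
  have -> : `|z - 1 / 2| = z - 1 / 2 by rewrite ger0_norm// subr_ge0 ltW.
  have -> : cos_partial M (z * (pi *+ 2)) = cos_partial M ((1 - z) * (pi *+ 2)).
    rewrite -(cos_partialN M (_ * _)) -(cos_partialDz M 1 (- _)); congr cos_partial.
    by rewrite mul1r mulrBl mul1r addrC.
  have -> : 4 * (z - 1 / 2) - 1 = 1 - 4 * (1 - z) by field.
  by apply: key; apply/andP; split; lra.
rewrite (ltr0_norm z0) -cos_partialN -[in X in cos_partial _ X]mulNr; have [zh|zh] := leP (- z) (1 / 2).
  have -> : `|- z - 1 / 2| = 1 / 2 + z by rewrite distrC ger0_norm ?opprK// -[X in _ + X]opprK subr_ge0.
  have -> : 4 * (1 / 2 + z) - 1 = 1 - 4 * (- z) by field.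
  by apply: key; apply/andP; split; lra.
have -> : `|- z - 1 / 2| = - z - 1 / 2 by rewrite ger0_norm// subr_ge0 ltW.
have -> : cos_partial M (- z * (pi *+ 2)) = cos_partial M ((1 + z) * (pi *+ 2)).
  rewrite -(cos_partialN M (_ * _)) -(cos_partialDz M 1 (- _)); congr cos_partial.
  by rewrite mul1r mulrDl mul1r mulNr opprD addrAC addNr add0r.
have -> : 4 * (- z - 1 / 2) - 1 = 1 - 4 * (1 + z) by field.
by apply: key; apply/andP; split; lra.
Qed.

Lemma tri_cos_expansion M x : (0 < M)%N ->
  `|tri_cos x - 8 / pi ^+ 2 * cos_partial M (x * (pi *+ 2))| <= M%:R^-1.
Proof.
move=> M0; rewrite /tri_cos /periodize.
have /andP[f0 f1] := fracpart_itv x.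
set f := x - _ in f0 f1 *.
have -> : cos_partial M (x * (pi *+ 2)) = cos_partial M (f * (pi *+ 2)).
  rewrite -(cos_partialDz M (Num.floor x) (f * _)); congr cos_partial.
  by rewrite -mulrDl subrK.
have := @triangle_wave_expansion M f M0.
by rewrite (ger0_norm f0); apply; apply/andP; split; lra.
Qed.

Lemma tri_sin_expansion M x : (0 < M)%N ->
  `|tri_sin x - 8 / pi ^+ 2 * cos_partial M (x * (pi *+ 2) - pi / 2)| <= M%:R^-1.
Proof.
move=> M0; rewrite /tri_sin /periodize.
have /andP[f0 f1] := fracpart_itv x.
set f := x - _ in f0 f1 *.
have -> : cos_partial M (x * (pi *+ 2) - pi / 2) = cos_partial M ((f - 1 / 4) * (pi *+ 2)).
  rewrite -(cos_partialDz M (Num.floor x) ((f - 1 / 4) * _)); congr cos_partial.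
  by rewrite /f -(mulr_natr pi 2); field.
have := @triangle_wave_expansion M (f - 1 / 4) M0.
have -> : 4 * `| `|f - 1 / 4| - 1 / 2| = `|2 - 4 * `|f - 1 / 4| | :> R.
  rewrite -{1}(ger0_norm (_ : 0 <= 4 :> R))// -normrM -normrN; congr `|_|; by field.
by apply; apply/andP; split; lra.
Qed.

(* Machin's formula pi / 4 = 4 atan (1/5) - atan (1/239). *)
Lemma pi_bounds : 1043 / 332 <= (pi : R) <= 3927 / 1250.
Proof.
pose a : R := atan (1 / 5); pose b : R := atan (1 / 239).
have ta : tan a = 1 / 5 by rewrite atanK.
have tb : tan b = 1 / 239 by rewrite atanK.
have h := @atan_sum_bound R 4 (1 / 5) (divr_ge0 ler01 (ler0n _ _)).
have h' := @atan_sum_bound R 1 (1 / 239) (divr_ge0 ler01 (ler0n _ _)).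
rewrite !big_ord_recr !big_ord0/= -/a -/b !doubleS !double0 in h h'.
have pi2 := pi_ge2 R.
rewrite !ler_norml in h h'.
move: h h' => /andP[a1 a2] /andP[b1 b2].
(* The addition formula for [tan] asks for nonvanishing cosines; it then gives [5/12], [120/119] and
   [1] at [2a], [4a] and [4a - b]. *)
have ca (k : R) : 0 <= k <= 4 -> cos (k * a - b) != 0 /\ cos (k * a) != 0.
  move=> /andP[k0 k4].
  have a0 : 0 <= a by lra.
  have h1 : 0 <= k * a by rewrite mulr_ge0.
  have h2 : k * a <= 4 * a by rewrite ler_wpM2r.
  by split; rewrite gt_eqF// cos_gt0_pihalf//; apply/andP; split; lra.
have t2 : tan (2 * a) = 5 / 12.
  have [_ c1] := ca 1 ltac:(apply/andP; split; lra).
  rewrite mul1r in c1.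
  by rewrite mulr_natl mulr2n tanD// ta; field.
have t4 : tan (4 * a) = 120 / 119.
  have [_ c2] := ca 2 ltac:(apply/andP; split; lra).
  by rewrite (_ : 4 * a = 2 * a + 2 * a) ?tanD// ?t2; field.
have [_ c4] := ca 4 ltac:(apply/andP; split; lra).
have [cb _] := ca 0 ltac:(apply/andP; split; lra).
rewrite mul0r sub0r in cb.
have t : tan (4 * a - b) = 1.
  by rewrite tanD// tanN t4 tb; field.
have : pi / 4 = 4 * a - b.
  rewrite -atan1; have := @tanK R (4 * a - b); rewrite t; apply.
  by rewrite in_itv/=; apply/andP; split; lra.
by move=> e; apply/andP; split; lra.
Qed.

(** With [v = 1/pi^2] the quantity is [96 * (2v - 1/8)^2], which increases with [v] as long as the
    base is nonnegative; the bounds for [pi] can then be inserted. *)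
Lemma riesz_lower_bounds :
  5787 / 10000 <= ((4 * Num.sqrt 6 / (pi : R) ^+ 2) * (2 - pi ^+ 2 / 8)) ^+ 2 < 5788 / 10000.
Proof.
have /andP[p1 p2] := pi_bounds.
set A := (X in _ <= X < _).
have p0 := pi_gt0 R.
pose v : R := (pi ^+ 2)^-1.
have -> : A = 96 * (2 * v - 1 / 8) ^+ 2.
  rewrite /A /v exprMn (_ : (4 * Num.sqrt 6 / pi ^+ 2) ^+ 2 = 96 / (pi ^+ 2) ^+ 2).
    have := lt0r_neq0 p0; move: (pi) => p pn0; by field.
  by rewrite exprMn exprMn sqr_sqrtr// exprVn; congr (_ / _); ring.
have inv_sq_le (a b : R) : 0 < a -> a <= b -> (b ^+ 2)^-1 <= (a^-1) ^+ 2.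
  move=> a0 ab; have b0 := lt_le_trans a0 ab.
  by rewrite exprVn lef_pV2 ?posrE ?exprn_gt0// lerXn2r// nnegrE ltW.
have inv_sq_ge (a b : R) : 0 < a -> a <= b -> (b^-1) ^+ 2 <= (a ^+ 2)^-1.
  move=> a0 ab; have b0 := lt_le_trans a0 ab.
  by rewrite exprVn lef_pV2 ?posrE ?exprn_gt0// lerXn2r// nnegrE ltW.
have v1 : v <= (332 / 1043) ^+ 2.
  by have := @inv_sq_le (1043 / 332) pi; rewrite invf_div; apply; [lra|exact: p1].
have v2 : (1250 / 3927) ^+ 2 <= v.
  by have := @inv_sq_ge pi (3927 / 1250) p0 p2; rewrite invf_div.
move: v v1 v2 => v v1 v2.
clear A p1 p2 p0.
pose u1 : R := 2 * (332 / 1043) ^+ 2 - 1 / 8.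
pose u2 : R := 2 * (1250 / 3927) ^+ 2 - 1 / 8.
set u := 2 * v - 1 / 8.
have u21 : 0 <= u2 by rewrite /u2; lra.
have uu1 : u <= u1 by rewrite /u /u1; lra.
have uu2 : u2 <= u by rewrite /u /u2; lra.
have : u2 ^+ 2 <= u ^+ 2 <= u1 ^+ 2.
  by rewrite !lerXn2r// nnegrE ?(le_trans u21)// (le_trans uu2).
by rewrite /u1 /u2 => /andP[? ?]; apply/andP; split; lra.
Qed.

End triangle_series.

(** * The space of square-integrable functions *)

Section L2.
Context d (T : measurableType d) (R : realType).
Variable mu : {measure set T -> \bar R}.
Implicit Types f g h : L2 mu.

Lemma L2norm_ge0 f : 0 <= L2norm f.
Proof. by rewrite /L2norm fine_ge0// Lnorm_ge0. Qed.

Lemma L2normD f g : L2norm (f + g) <= L2norm f + L2norm g.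
Proof. exact: ler_LnormD. Qed.

Lemma L2normZ a f : L2norm (a *: f) = `|a| * L2norm f.
Proof.
apply: EFin_inj; rewrite EFinM /L2norm !finite_norm_fine.
exact: LnormZ.
Qed.

Lemma L2norm0 : L2norm (0 : L2 mu) = 0.
Proof. by rewrite -(scale0r (0 : L2 mu)) L2normZ normr0 mul0r. Qed.

Lemma L2normN f : L2norm (- f) = L2norm f.
Proof. by rewrite -scaleN1r L2normZ normrN1 mul1r. Qed.

Lemma L2normB f g : L2norm (f - g) = L2norm (g - f).
Proof. by rewrite -L2normN opprB. Qed.

Lemma L2norm_sum (I : Type) (r : seq I) (F : I -> L2 mu) :
  L2norm (\sum_(i <- r) F i) <= \sum_(i <- r) L2norm (F i).
Proof.
elim: r => [|i r IH]; first by rewrite !big_nil L2norm0.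
by rewrite !big_cons (le_trans (L2normD _ _))// lerD2l.
Qed.

Lemma L2norm_dist f g : `|L2norm f - L2norm g| <= L2norm (f - g).
Proof.
have h1 : L2norm f <= L2norm (f - g) + L2norm g by rewrite -[in leLHS](subrK g f) L2normD.
have h2 : L2norm g <= L2norm (f - g) + L2norm f.
  by rewrite L2normB -[in leLHS](subrK f g) L2normD.
by rewrite ler_norml; apply/andP; split; lra.
Qed.

Lemma L2_sumE (I : Type) (r : seq I) (F : I -> L2 mu) x :
  (\sum_(i <- r) F i : L2 mu) x = \sum_(i <- r) F i x.
Proof. by elim: r => [|i r IH]; rewrite ?big_nil// !big_cons -IH. Qed.

Lemma L2_measurable f : measurable_fun setT f.
Proof. exact: measurable_funPT. Qed.

Lemma L2norm_sqE f : (L2norm f ^+ 2)%:E = (\int[mu]_x (f x ^+ 2)%:E)%E.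
Proof.
rewrite -powR_mulrn ?L2norm_ge0// -poweR_EFin /L2norm finite_norm_fine poweR_Lnorm//.
by apply: eq_integral => x _; rewrite abse_EFin poweR_EFin powR_mulrn// -normrX ger0_norm ?sqr_ge0.
Qed.

Lemma ae_le_L2norm f g : (\forall x \ae mu, `|f x| <= `|g x|) ->
  L2norm f <= L2norm g.
Proof.
move=> fg; rewrite -(@ler_sqr _ (L2norm f)) ?nnegrE ?L2norm_ge0// -lee_fin !L2norm_sqE.
have m2 (h : L2 mu) : measurable_fun setT (fun x => (h x ^+ 2)%:E).
  exact/measurable_EFinP/measurable_funX/L2_measurable.
apply: ae_ge0_le_integral => //.
- by move=> x _; rewrite lee_fin sqr_ge0.
- by move=> x _; rewrite lee_fin sqr_ge0.
apply: filterS fg => x fg _; rewrite lee_fin -[leLHS]real_normK ?num_real//.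
by rewrite -[leRHS]real_normK ?num_real// lerXn2r ?nnegrE.
Qed.

Lemma le_L2norm f g : (forall x, `|f x| <= `|g x|) -> L2norm f <= L2norm g.
Proof. by move=> fg; apply: ae_le_L2norm; exact: nearW. Qed.

Lemma L2norm_ae0 f : (\forall x \ae mu, f x = 0) -> L2norm f = 0.
Proof.
move=> f0; apply/eqP; rewrite eq_le L2norm_ge0 andbT -L2norm0.
by apply: ae_le_L2norm; apply: filterS f0 => x ->; rewrite normr0.
Qed.

(** * The inner product *)

Definition dot f g : R := \int[mu]_x (f x * g x).

Lemma dot_integrable f g : mu.-integrable setT (EFin \o (fun x => f x * g x)).
Proof.
have := Lfun2_mul_Lfun1 (LfunP f) (LfunP g).
by move/Lfun1_integrable.
Qed.

Lemma dotC f g : dot f g = dot g f.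
Proof. by rewrite /dot; apply: eq_Rintegral => x _; rewrite mulrC. Qed.

Lemma dotDl f g h : dot (f + g) h = dot f h + dot g h.
Proof.
rewrite /dot -RintegralD//; [|exact: dot_integrable..].
by apply: eq_Rintegral => x _; rewrite -mulrDl.
Qed.

Lemma dotZl a f h : dot (a *: f) h = a * dot f h.
Proof.
rewrite /dot -RintegralZl//; last exact: dot_integrable.
by apply: eq_Rintegral => x _; rewrite mulrA.
Qed.

Lemma dot_suml (I : Type) (r : seq I) (F : I -> L2 mu) h :
  dot (\sum_(i <- r) F i) h = \sum_(i <- r) dot (F i) h.
Proof.
elim: r => [|i r IH]; last by rewrite !big_cons dotDl IH.
by rewrite !big_nil -(scale0r (0 : L2 mu)) dotZl mul0r.
Qed.

Lemma dot_sumr (I : Type) (r : seq I) (F : I -> L2 mu) h :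
  dot h (\sum_(i <- r) F i) = \sum_(i <- r) dot h (F i).
Proof. by rewrite dotC dot_suml; apply: eq_bigr => i _; rewrite dotC. Qed.

Lemma L2norm_sq f : L2norm f ^+ 2 = dot f f.
Proof.
apply: EFin_inj; rewrite L2norm_sqE /dot /Rintegral fineK.
  by apply: eq_integral => x _; rewrite expr2.
by apply: integrable_fin_num => //; exact: dot_integrable.
Qed.

(** * Dominated convergence and completeness *)

(** The squared differences are dominated by [4 * g^2], which is integrable because [g] lies in
    [L2]. *)
Lemma L2_dominated (f_ : nat -> L2 mu) f g :
  (\forall x \ae mu, forall n, `|f_ n x| <= g x) ->
  (\forall x \ae mu, `|f x| <= g x) ->
  (\forall x \ae mu, f_ ^~ x @ \oo --> f x) ->
  L2norm (f - f_ n) @[n --> \oo] --> 0.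
Proof.
move=> fg_ fg ff.
have [] := @dominated_convergence _ _ _ mu setT measurableT
   (fun n x => ((f x - f_ n x) ^+ 2)%:E) (cst 0%E) (fun x => (4 * (g x * g x))%:E).
- move=> n; apply/measurable_EFinP/measurable_funX/measurable_funB; exact: L2_measurable.
- exact: measurable_cst.
- apply: filterS ff => x ff _.
  apply/cvg_EFin; first exact: nearW.
  rewrite -[X in _ --> X](_ : (f x - f x) * (f x - f x) = _); last by rewrite subrr mul0r.
  rewrite (_ : _ \o _ = fun n => (f x - f_ n x) * (f x - f_ n x)); last first.
    by apply/funext => n /=; rewrite expr2.
  by apply: cvgM; apply: cvgB => //; exact: cvg_cst.
- have := integrableZl measurableT 4 (dot_integrable g g).
  by apply: eq_integrable => // x _; rewrite EFinM.
- apply: filterS2 fg_ fg => x fg_x fgx n _; rewrite lee_fin ger0_norm ?sqr_ge0//.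
  move: (fg_x n) fgx; rewrite !ler_norml => /andP[? ?] /andP[? ?]; nra.
- rewrite integral0 => _ _ h.
  have h2 : (L2norm (f - f_ n)) ^+ 2 @[n --> \oo] --> 0.
    have /fine_cvgP[_] := h; apply: cvg_trans; apply: near_eq_cvg.
    by apply: nearW => n; rewrite -[RHS]/(fine (_%:E)) L2norm_sqE.
  apply/cvgrPdist_lt => e e0.
  have e2 : 0 < e ^+ 2 by rewrite exprn_gt0.
  move/cvgrPdist_lt : h2 => /(_ _ e2); apply: filterS => n.
  rewrite !sub0r !normrN normrX ltr_pXn2r ?nnegrE// ?ltW//.
Qed.

Lemma Lfun2P (u : T -> R) : measurable_fun setT u ->
  (\int[mu]_x (u x ^+ 2)%:E < +oo)%E -> u \in Lfun mu 2%:E.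
Proof.
move=> mu_ foo; rewrite inE; apply/andP; split; rewrite inE//=.
rewrite /finite_norm unlock poweR_lty//; apply: le_lt_trans foo.
rewrite le_eqVlt; apply/orP; left; apply/eqP; apply: eq_integral => x _.
by rewrite /= powR_mulrn// -normrX ger0_norm ?sqr_ge0.
Qed.

Lemma limn_einf_le (u : (\bar R)^nat) c : (forall n, u n <= c)%E -> (limn_einf u <= c)%E.
Proof.
move=> uc; rewrite limn_einf_lim; apply: lime_le; first exact: is_cvg_einfs.
apply: nearW => n; apply: le_trans (uc n); apply: ereal_inf_lbound.
by exists n => //=.
Qed.

Lemma limn_einf_ge0 (u : (\bar R)^nat) : (forall n, 0 <= u n)%E -> (0 <= limn_einf u)%E.
Proof.
move=> u0; rewrite limn_einf_lim; apply: lime_ge; first exact: is_cvg_einfs.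
by apply: nearW => n; apply: le_ereal_inf_tmp => _ [m /= _ <-].
Qed.

Lemma geometric_dist_cvg (u : R^nat) K :
  (forall n, `|u n.+1 - u n| <= K * 2^-1 ^+ n) -> cvgn u.
Proof.
move=> uK.
suff : cvgn (series (fun n => u n.+1 - u n)).
  have -> : series (fun n => u n.+1 - u n) = (fun n => u n - u 0%N).
    by apply/funext => n; rewrite seriesEnat/= telescope_sumr.
  move=> h; rewrite (_ : u = (fun n => (u n - u 0%N) + u 0%N)).
    by apply: is_cvgD => //; exact: is_cvg_cst.
  by apply/funext => n; rewrite subrK.
apply: normed_cvg; apply: (@series_le_cvg _ _ (geometric K 2^-1)).
- by move=> n /=.
- by move=> n; apply: le_trans (uK n).
- exact: uK.
- by apply: is_cvg_geometric_series; rewrite ger0_norm// invf_lt1// ltr1n.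
Qed.

(** Riesz-Fischer: a rapidly converging subsequence converges almost everywhere, and Fatou's lemma
    turns its pointwise limit into a limit in norm. *)
Lemma L2_complete (f : nat -> L2 mu) :
  (forall e, 0 < e -> exists N, forall n m, (N <= n)%N -> (N <= m)%N ->
    L2norm (f n - f m) < e) ->
  exists s, L2norm (s - f n) @[n --> \oo] --> 0.
Proof.
move=> fC.
have /choice[N hN] : forall i, exists N, forall n m, (N <= n)%N -> (N <= m)%N ->
    L2norm (f n - f m) < 4^-1 ^+ i.
  by move=> i; apply: fC; rewrite exprn_gt0.
(* The sum is at least every threshold [N j] with [j <= i], so all later indices keep meeting the
   earlier requirements. *)
pose M i := (\sum_(j < i.+1) N j)%N.
have MN i j : (i <= j)%N -> (N i <= M j)%N.
  move=> ij; have ij1 : (i < j.+1)%N by [].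
  by rewrite /M (bigD1 (Ordinal ij1))//= leq_addr.
pose g i := f (M i).
have gC i j : (i <= j)%N -> L2norm (g j - g i) < 4^-1 ^+ i.
  by move=> ij; apply: hN; exact: MN.
(* The weight [4^i] against squared gaps below [16^-i] keeps the series integrable, while finiteness
   of its sum forces pointwise gaps of order [2^-i]. *)
pose h i x := (4 ^+ i * (g i.+1 x - g i x) ^+ 2)%:E : \bar R.
have h0 i x : (0 <= h i x)%E by rewrite lee_fin mulr_ge0// sqr_ge0.
have mg2 i j : measurable_fun setT (fun x => ((g j x - g i x) ^+ 2)%:E).
  by apply/measurable_EFinP/measurable_funX/measurable_funB; exact: L2_measurable.
have mh i : measurable_fun setT (h i).
  apply/measurable_EFinP/measurable_funM => //; apply/measurable_funX/measurable_funB; exact: L2_measurable.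
pose G x := (\sum_(0 <= i <oo) h i x)%E.
have intG : (\int[mu]_x G x < +oo)%E.
  rewrite integral_nneseries//.
  apply: (@le_lt_trans _ _ 2%:E); last exact: ltry.
  apply: lime_le; first by apply: is_cvg_nneseries => n _ _; exact: integral_ge0.
  apply: nearW => n.
  (* Strengthened from [2] for the induction: the [n]-th term is at most [4^-n], while this bound
     grows by [3/2 * 4^-n]. *)
  apply: (@le_trans _ _ (2 - 2 * 4^-1 ^+ n)%:E); last by rewrite lee_fin gerBl mulr_ge0.
  elim: n => [|n IH]; first by rewrite big_geq// lee_fin expr0; lra.
  rewrite big_nat_recr//=; apply: (le_trans (leeD2r _ IH)).
  have -> : (\int[mu]_x h n x = (4 ^+ n * L2norm (g n.+1 - g n) ^+ 2)%:E)%E.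
    rewrite EFinM L2norm_sqE -ge0_integralZl//; [exact: (mg2 n n.+1)|].
    by move=> x _; rewrite lee_fin sqr_ge0.
  rewrite -EFinD lee_fin [4^-1 ^+ n.+1]exprS.
  have h1 : L2norm (g n.+1 - g n) ^+ 2 <= (4^-1 ^+ n) ^+ 2.
    by rewrite lerXn2r ?nnegrE ?L2norm_ge0// ltW// gC.
  have h2 : 4 ^+ n * L2norm (g n.+1 - g n) ^+ 2 <= 4^-1 ^+ n.
    rewrite [leRHS](_ : _ = 4 ^+ n * (4^-1 ^+ n) ^+ 2) ?ler_pM2l ?exprn_gt0//.
    by rewrite expr2 mulrA -exprMn divff// expr1n mul1r.
  have h3 : 0 <= 4^-1 ^+ n :> R by [].
  by lra.
have mG : measurable_fun setT G by exact: ge0_emeasurable_sum.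
have aeG : \forall x \ae mu, G x \is a fin_num.
  have iG : mu.-integrable setT G.
    apply/integrableP; split => //; under eq_integral => x _.
      rewrite gee0_abs; last exact: nneseries_ge0.
      over.
    exact: intG.
  by have := integrable_ae measurableT iG; apply: filterS => x; apply.
have gcvg : \forall x \ae mu, cvgn (fun n => g n x).
  apply: filterS aeG => x Gx.
  pose K := 1 + fine (G x).
  have G0 : (0 <= G x)%E by apply: nneseries_ge0.
  have K1 : 1 <= K by rewrite lerDl fine_ge0.
  apply: (@geometric_dist_cvg _ K) => n.
  have hn : (h n x <= G x)%E.
    have := @nneseries_lim_ge _ (h ^~ x) xpredT 0 n.+1 (fun i _ _ => h0 i x).
    by apply: le_trans; rewrite big_nat_recr//= leeDr// sume_ge0.
  have {hn} hn : 4 ^+ n * (g n.+1 x - g n x) ^+ 2 <= K ^+ 2.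
    apply: (@le_trans _ _ (fine (G x))); first by rewrite -lee_fin fineK.
    apply: (@le_trans _ _ K); first by rewrite lerDr.
    by rewrite expr2 ler_peMl// (le_trans _ K1).
  rewrite -ler_sqr ?nnegrE// ?mulr_ge0 ?(le_trans _ K1)//.
  rewrite real_normK ?num_real// exprMn -exprM mulnC exprM.
  rewrite -(ler_pM2l (_ : 0 < 4 ^+ n))// [leRHS]mulrCA.
  rewrite -exprMn (_ : 4 * 2^-1 ^+ 2 = 1) ?expr1n ?mulr1//; lra.
(* The upper limit is measurable and is defined also at the points where [g n x] diverges. *)
pose s0 x := fine (limn_esup (fun n => (g n x)%:E)).
have ms0 : measurable_fun setT s0.
  apply: measurableT_comp => //; apply: measurable_fun_limn_esup => n.
  exact/measurable_EFinP/L2_measurable.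
have gs0 : \forall x \ae mu, g n x @[n --> \oo] --> s0 x.
  apply: filterS gcvg => x /cvg_ex[l gl].
  suff -> : s0 x = l by [].
  rewrite /s0 (cvg_limn_einf_sup (_ : _ --> l%:E)).2//.
  by apply/cvg_EFin => //; exact: nearW.
have sg i : (\int[mu]_x ((s0 x - g i x) ^+ 2)%:E <= ((4^-1 ^+ i) ^+ 2)%:E)%E.
  apply: (@le_trans _ _ (\int[mu]_x limn_einf (fun n => ((g (n + i)%N x - g i x) ^+ 2)%:E))%E).
    rewrite le_eqVlt; apply/orP; left; apply/eqP.
    apply: ge0_ae_eq_integral => //.
    - by apply/measurable_EFinP/measurable_funX/measurable_funB => //; exact: L2_measurable.
    - rewrite (_ : (fun x => _) = fun x =>
          (- limn_esup (fun n => - ((g (n + i)%N x - g i x) ^+ 2)%:E))%E).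
        apply: measurableT_comp => //; apply: measurable_fun_limn_esup => n.
        by apply: measurableT_comp => //; exact: mg2.
      apply/funext => x; rewrite -limn_einfN; congr limn_einf.
      by apply/funext => n; exact/esym/oppeK.
    - by move=> x _; rewrite lee_fin sqr_ge0.
    - move=> x _; by apply: limn_einf_ge0 => n; rewrite lee_fin sqr_ge0.
    - apply: filterS gs0 => x gs _.
      rewrite (cvg_limn_einf_sup (_ : _ --> ((s0 x - g i x) ^+ 2)%:E)).1//.
      apply/cvg_EFin; first exact: nearW.
      rewrite (_ : _ \o _ = fun n => (g (n + i)%N x - g i x) ^+ 2)//.
      rewrite expr2 (_ : (fun n => _) = fun n => (g (n + i)%N x - g i x) * (g (n + i)%N x - g i x)); last first.
        by apply/funext => n; rewrite expr2.
      have gsi : g (n + i)%N x @[n --> \oo] --> s0 x by rewrite (cvg_shiftn i (fun n => g n x)).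
      by apply: cvgM; apply: cvgB => //; exact: cvg_cst.
  apply: (le_trans (fatou _ _ _ _)) => //.
    by move=> n x _; rewrite lee_fin sqr_ge0.
  apply: limn_einf_le => n.
  rewrite -[leLHS]/(\int[mu]_x (((g (n + i)%N - g i : L2 mu) x) ^+ 2)%:E)%E -L2norm_sqE lee_fin.
  by rewrite lerXn2r ?nnegrE ?L2norm_ge0// ltW// gC// leq_addl.
have s0g : (fun x => s0 x - g 0%N x) \in Lfun mu 2%:E.
  apply: Lfun2P; first by apply: measurable_funB => //; exact: L2_measurable.
  by apply: le_lt_trans (sg 0%N) _; exact: ltry.
pose s : L2 mu := Lfun_Sub (lee1n 2) s0g + g 0%N.
have sE x : s x = s0 x by rewrite /s -[LHS]/(s0 x - g 0%N x + g 0%N x) subrK.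
have sgn i : L2norm (s - g i) <= 4^-1 ^+ i.
  rewrite -(@ler_sqr _ (L2norm _)) ?nnegrE ?L2norm_ge0// -lee_fin L2norm_sqE.
  rewrite (eq_integral (fun x => ((s0 x - g i x) ^+ 2)%:E)) ?sg// => x _.
  by rewrite -[(s - g i) x]/(s x - g i x) sE.
exists s; apply/cvgrPdist_lt => e e0.
have : 4^-1 ^+ n @[n --> \oo] --> (0 : R).
  by apply: cvg_expr; rewrite ger0_norm// invf_lt1// ltr1n.
move=> /cvgrPdist_lt /(_ (e / 2)); rewrite divr_gt0// => /(_ isT)[k _ hk].
have {hk} := hk k (leqnn _); rewrite /= sub0r normrN ger0_norm// => hk.
exists (M k) => // n /= Mn; rewrite sub0r normrN ger0_norm ?L2norm_ge0//.
rewrite -(subrK (g k) s) -addrA (le_lt_trans (L2normD _ _))//.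
have h1 := sgn k.
have h2 : L2norm (g k - f n) < 4^-1 ^+ k.
  by apply: hN; [exact: MN|rewrite (leq_trans _ Mn)// MN].
lra.
Qed.

Lemma L2_bounded (u : T -> R) (mu_ : measurable_fun setT u) (c : R)
    (muT : (mu setT < +oo)%E) (uc : forall x, `|u x| <= c) : u \in Lfun mu 2%:E.
Proof.
apply: Lfun2P => //.
apply: (@le_lt_trans _ _ (\int[mu]_x (cst (c ^+ 2)%:E x))%E).
  apply: ge0_le_integral => //=.
  - by move=> x _; rewrite lee_fin sqr_ge0.
  - exact/measurable_EFinP/measurable_funX.
  - move=> x _; rewrite lee_fin -[leLHS]real_normK ?num_real//.
    by rewrite lerXn2r ?nnegrE// (le_trans _ (uc x)).
by rewrite integral_cst// lte_mul_pinfty ?lee_fin ?sqr_ge0.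
Qed.

Hypothesis muT : mu setT = 1%E.

Lemma L2norm_le_cst f c : (forall x, `|f x| <= c) -> L2norm f <= c.
Proof.
move=> fc; have c0 : 0 <= c.
  rewrite leNgt; apply/negP => c0.
  have : mu setT = 0%E.
    rewrite (_ : setT = set0) ?measure0//; apply/seteqP; split => // x _ /=.
    by have := le_lt_trans (le_trans (normr_ge0 _) (fc x)) c0; rewrite ltxx.
  by rewrite muT => -[] /eqP; rewrite oner_eq0.
rewrite -(@ler_sqr _ (L2norm f)) ?nnegrE ?L2norm_ge0// -lee_fin L2norm_sqE.
apply: (@le_trans _ _ (\int[mu]_x (cst (c ^+ 2)%:E x))%E).
  apply: ge0_le_integral => //=.
  - by move=> x _; rewrite lee_fin sqr_ge0.
  - exact/measurable_EFinP/measurable_funX/L2_measurable.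
  - move=> x _; rewrite lee_fin -[leLHS]real_normK ?num_real//.
    by rewrite lerXn2r ?nnegrE.
by rewrite integral_cst// muT mule1.
Qed.

End L2.

(** * Riesz bases and perturbation of orthonormal systems *)

Section riesz_abstract.
Context d (T : measurableType d) (R : realType).
Variable mu : {measure set T -> \bar R}.
Variables (J : choiceType) (phi : J -> L2 mu).

Definition comb (alpha : J -> R) (F : {fset J}) : L2 mu :=
  \sum_(j <- F) alpha j *: phi j.

Lemma fset_sum_sub (V : zmodType) (u : J -> V) (F0 F : {fset J}) : (F0 `<=` F)%fset ->
  \sum_(j <- F) u j = \sum_(j <- F0) u j + \sum_(j <- (F `\` F0)%fset) u j.
Proof.
move=> sub; rewrite (bigID (fun j => j \in F0))/=; congr (_ + _).
  rewrite -big_filter; apply: perm_big; apply: uniq_perm => //.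
    by rewrite filter_uniq.
  move=> j; rewrite mem_filter andb_idr// => jF0.
  exact: (fsubsetP sub).
rewrite -big_filter; apply: perm_big; apply: uniq_perm => //.
  by rewrite filter_uniq.
by move=> j; rewrite mem_filter inE.
Qed.

Lemma comb_add F F' alpha alpha' : exists G beta,
  comb alpha F + comb alpha' F' = comb beta G.
Proof.
have sumU (V : zmodType) (u : J -> V) (G G' : {fset J}) : (G `<=` G')%fset ->
    \sum_(j <- G') (if j \in G then u j else 0) = \sum_(j <- G) u j.
  move=> sub; rewrite (fset_sum_sub _ sub) [X in _ + X]big1_seq ?addr0.
    by apply: eq_big_seq => j ->.
  by move=> j /= /fsetDP[_ /negPf->].
exists (F `|` F')%fset, (fun j => (if j \in F then alpha j else 0) +
  (if j \in F' then alpha' j else 0)).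
rewrite /comb; under [RHS]eq_bigr do rewrite scalerDl.
rewrite big_split/=; congr (_ + _).
  rewrite -(sumU _ _ _ _ (fsubsetUl F F')); apply: eq_bigr => j _.
  by case: ifP => // _; rewrite scale0r.
rewrite -(sumU _ _ _ _ (fsubsetUr F F')); apply: eq_bigr => j _.
by case: ifP => // _; rewrite scale0r.
Qed.

(** * Distance to the closed span *)

(** The distance from [f] to the span is at most [r]; [r = 0] is membership in the closed span. A
    general [r] is kept because the perturbation argument shrinks it by the factor [q] in each
    round. *)
Definition near_span (r : R) (f : L2 mu) := forall eps : R, 0 < eps ->
  exists F alpha, L2norm (f - comb alpha F) < r + eps.

Lemma near_spanD r r' f f' : near_span r f -> near_span r' f' ->
  near_span (r + r') (f + f').
Proof.
move=> h h' e e0; have e2 : 0 < e / 2 by rewrite divr_gt0.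
have [F [a Fa]] := h _ e2; have [F' [a' Fa']] := h' _ e2.
have [G [b Gb]] := comb_add F F' a a'.
exists G, b; rewrite -Gb opprD addrACA (le_lt_trans (L2normD _ _))//.
by rewrite [in ltRHS](splitr e) [ltRHS]addrACA ltrD.
Qed.

Lemma near_span_le r r' f : r <= r' -> near_span r f -> near_span r' f.
Proof.
move=> rr' h e e0; have [F [a Fa]] := h _ e0; exists F, a.
by rewrite (lt_le_trans Fa)// lerD2r.
Qed.

Lemma near_spanZ r a f : near_span r f -> near_span (`|a| * r) (a *: f).
Proof.
move=> h e e0; have a1 : 0 < `|a| + 1 by rewrite ltr_wpDl.
have [F [b Fb]] := h _ (divr_gt0 e0 a1).
exists F, (fun j => a * b j).
have -> : comb (fun j => a * b j) F = a *: comb b F.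
  by rewrite /comb scaler_sumr; apply: eq_bigr => j _; rewrite scalerA.
rewrite -scalerBr L2normZ.
have [->|an0] := eqVneq a 0; first by rewrite normr0 !mul0r add0r.
have a0 : 0 < `|a| by rewrite normr_gt0.
apply: (@lt_le_trans _ _ (`|a| * (r + e / (`|a| + 1)))); first by rewrite ltr_pM2l.
rewrite mulrDr lerD2l mulrA ler_pdivrMr// mulrDr mulr1 mulrC lerDl ltW//.
Qed.

Lemma near_span_sum (I : Type) (s : seq I) (r : I -> R) (f : I -> L2 mu) :
  (forall i, near_span (r i) (f i)) ->
  near_span (\sum_(i <- s) r i) (\sum_(i <- s) f i).
Proof.
move=> h; elim: s => [|i s IH]; last by rewrite !big_cons; exact: near_spanD.
rewrite !big_nil => e e0; exists fset0, (fun=> 0).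
by rewrite /comb big_seq_fset0 subr0 L2norm0 add0r.
Qed.

Lemma near_span_norm f : near_span (L2norm f) f.
Proof.
by move=> e e0; exists fset0, (fun=> 0); rewrite /comb big_seq_fset0 subr0 ltrDl.
Qed.

Lemma near_span_phi j : near_span 0 (phi j).
Proof.
move=> e e0; exists [fset j]%fset, (fun=> 1).
by rewrite /comb big_seq_fset1 scale1r subrr L2norm0 add0r.
Qed.

Lemma near_span_lim r f :
  (forall e, 0 < e -> exists2 g, L2norm (f - g) < e & near_span r g) -> near_span r f.
Proof.
move=> h e e0; have e2 : 0 < e / 2 by rewrite divr_gt0.
have [g fg gr] := h _ e2; have [F [a Fa]] := gr _ e2.
exists F, a; rewrite -(subrK g f) -addrA (le_lt_trans (L2normD _ _))//.
lra.
Qed.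

Lemma near_span_inf r f : (forall e, 0 < e -> near_span (r + e) f) -> near_span r f.
Proof.
move=> h e e0; have e2 : 0 < e / 2 by rewrite divr_gt0.
have [F [a Fa]] := h _ e2 _ e2; exists F, a; lra.
Qed.

(** Two-sided bounds on finite sums suffice: the upper one makes the finite partial sums a Cauchy
    net, completeness yields the limit, and both bounds pass to it. *)
Lemma riesz_sum (A B : R) : 0 <= B ->
  (forall (F : {fset J}) alpha, A * \sum_(j <- F) alpha j ^+ 2 <= L2norm (comb alpha F) ^+ 2
    <= B * \sum_(j <- F) alpha j ^+ 2) ->
  forall alpha : J -> R,
    let S := (\esum_(j in [set: J]) (alpha j ^+ 2)%:E)%E in
    (S < +oo)%E ->
    exists s : L2 mu,
      L2_has_sum (fun j => alpha j *: phi j) s /\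
      (A%:E * S <= (L2norm s ^+ 2)%:E <= B%:E * S)%E.
Proof.
move=> B0 bd alpha S Soo.
pose N (F : {fset J}) := \sum_(j <- F) alpha j ^+ 2.
have NS F : ((N F)%:E <= S)%E.
  apply: ereal_sup_ubound; exists [set` F]; first by split.
  by rewrite fsbig_finite//= set_fsetK /N sumEFin.
have S0 : (0 <= S)%E by have := NS fset0; rewrite /N big_seq_fset0.
have SE : S = (fine S)%:E by rewrite fineK// ge0_fin_numE.
set s0 := fine S in SE.
have Ns0 F : N F <= s0 by rewrite -lee_fin -SE.
have adh e : 0 < e -> exists F, s0 - e < N F.
  move=> e0; have Sfin : ereal_sup [set (\sum_(x \in A) (alpha x ^+ 2)%:E)%E | A in fsets [set: J]] \is a fin_num.
    by rewrite -/(esum _ _) -/S SE.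
  have [_ [D [finD _] <-]] := ub_ereal_sup_adherent e0 Sfin.
  rewrite -/(esum _ _) -/S SE fsbig_finite//= sumEFin -EFinB lte_fin => h.
  by exists (fset_set D).
(* A finite set that collects all but [del] of [S] leaves less than [del] to any disjoint finite
   set, so enlarging it hardly moves the partial sum. This gives both the Cauchy property and
   convergence along the net. *)
have key e : 0 < e -> exists2 del, 0 < del & forall F0, s0 - del < N F0 ->
    forall F, (F0 `<=` F)%fset -> L2norm (comb alpha F - comb alpha F0) < e.
  move=> e0; have B1 : 0 < B + 1 by rewrite ltr_wpDl.
  exists (e ^+ 2 / (B + 1)); first by rewrite divr_gt0 ?exprn_gt0.
  move=> F0 hF0 F sub.
  have -> : comb alpha F - comb alpha F0 = comb alpha (F `\` F0)%fset.
    by rewrite /comb (fset_sum_sub _ sub) addrAC subrr add0r.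
  have NFF0 : N (F `\` F0)%fset = N F - N F0.
    by rewrite /N (fset_sum_sub _ sub) addrAC subrr add0r.
  rewrite -ltr_sqr ?nnegrE ?L2norm_ge0 ?ltW//.
  have /andP[_] := bd (F `\` F0)%fset alpha; rewrite -/(N _) NFF0.
  move/le_lt_trans; apply.
  have h1 : N F - N F0 < e ^+ 2 / (B + 1) by have := Ns0 F; lra.
  have h2 : 0 <= N F - N F0 by rewrite -NFF0 sumr_ge0// => j _; exact: sqr_ge0.
  move: h1; rewrite ltr_pdivlMr//; nra.
have inv0 (e : R) : 0 < e -> exists k, forall n, (k <= n)%N -> n.+1%:R^-1 < e.
  move=> e0; exists (Num.truncn e^-1) => n kn.
  rewrite -[ltRHS]invrK ltf_pV2 ?posrE ?invr_gt0//.
  by rewrite (lt_le_trans (truncnS_gt _))// ler_nat.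
have /choice[G hG] : forall n, exists F, s0 - n.+1%:R^-1 < N F.
  by move=> n; apply: adh; rewrite invr_gt0.
have [e e0|s hs] := @L2_complete _ _ _ mu (fun n => comb alpha (G n)).
  have [|del del0 hdel] := key (e / 2); first by rewrite divr_gt0.
  have [k hk] := inv0 _ del0; exists k => n m kn km.
  have hn : s0 - del < N (G n) by rewrite (lt_trans _ (hG n))// ltrD2l ltrN2 hk.
  have hm : s0 - del < N (G m) by rewrite (lt_trans _ (hG m))// ltrD2l ltrN2 hk.
  have := hdel _ hn _ (fsubsetUl (G n) (G m)).
  have := hdel _ hm _ (fsubsetUr (G n) (G m)).
  set f := comb alpha (_ `|` _)%fset => h1 h2.
  rewrite -(subrK f (comb alpha (G n))) -addrA (le_lt_trans (L2normD _ _))//.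
  by rewrite L2normB; lra.
have cN : N (G n) @[n --> \oo] --> s0.
  apply/cvgrPdist_lt => e e0; have [k hk] := inv0 _ e0.
  exists k => // n /= kn; rewrite ger0_norm ?subr_ge0//.
  by rewrite ltrBlDr -ltrBlDl (lt_trans _ (hG n))// ltrD2l ltrN2 hk.
have cs : L2norm (comb alpha (G n)) @[n --> \oo] --> L2norm s.
  apply/cvgrPdist_lt => e e0; move/cvgrPdist_lt : hs => /(_ _ e0).
  apply: filterS => n; rewrite sub0r normrN ger0_norm ?L2norm_ge0//.
  exact/le_lt_trans/L2norm_dist.
have cs2 : L2norm (comb alpha (G n)) ^+ 2 @[n --> \oo] --> L2norm s ^+ 2.
  by rewrite expr2; under eq_cvg do rewrite expr2; exact: cvgM.
exists s; split.
  move=> e e0; have e2 : 0 < e / 2 by rewrite divr_gt0.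
  have [del del0 hdel] := key _ e2.
  have [k hk] := inv0 _ del0.
  move/cvgrPdist_lt : hs => /(_ _ e2)[k' _ hk'].
  have := hk' (maxn k k') (leq_maxr _ _).
  rewrite sub0r normrN ger0_norm ?L2norm_ge0// => h1.
  exists (G (maxn k k')) => F sub.
  have h2 : s0 - del < N (G (maxn k k')).
    by rewrite (lt_trans _ (hG _))// ltrD2l ltrN2 hk// leq_maxl.
  have := hdel _ h2 _ sub; rewrite L2normB => h3.
  rewrite -/(comb _ _) -(subrK (comb alpha (G (maxn k k'))) s) -addrA.
  by rewrite (le_lt_trans (L2normD _ _))//; lra.
rewrite SE -!EFinM !lee_fin; apply/andP; split.
  apply: (ler_cvg_to (cvgM (cvg_cst A) cN) cs2).
  by apply: nearW => n; have /andP[] := bd (G n) alpha.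
apply: (ler_cvg_to cs2 (cvgM (cvg_cst B) cN)).
by apply: nearW => n; have /andP[] := bd (G n) alpha.
Qed.

(* For the system of triangular waves, [g i j] is the [i]-th odd harmonic of [phi j]. *)
Section perturbation.
Variables (g : nat -> J -> L2 mu) (w : nat -> R) (c q : R).
Hypothesis c0 : 0 < c.
Hypothesis q01 : 0 <= q < 1.
Hypothesis w0 : w 0%N = 1.
Hypothesis w_ge0 : forall i, 0 <= w i.
Hypothesis wq : forall M, \sum_(i < M) w i.+1 <= q.
Hypothesis g0 : forall (F : {fset J}) alpha,
  L2norm (\sum_(j <- F) alpha j *: g 0%N j) ^+ 2 = \sum_(j <- F) alpha j ^+ 2.
Hypothesis gi : forall i (F : {fset J}) alpha,
  L2norm (\sum_(j <- F) alpha j *: g i j) ^+ 2 <= \sum_(j <- F) alpha j ^+ 2.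
Hypothesis gphi : forall j,
  L2norm (phi j - c *: \sum_(i < M.+1) w i *: g i j) @[M --> \oo] --> 0.

Lemma cvg_sum0 (r : seq J) (u : J -> nat -> R) :
  (forall j, u j n @[n --> \oo] --> 0) -> \sum_(j <- r) u j n @[n --> \oo] --> 0.
Proof.
move=> u0; elim: r => [|j r IH].
  by under eq_cvg do rewrite big_nil; exact: cvg_cst.
rewrite (_ : (fun n => _) = (fun n => u j n + \sum_(i <- r) u i n)); last first.
  by apply/funext => n; rewrite big_cons.
have h := cvgD (u0 j) IH; rewrite addr0 in h; exact: h.
Qed.

(** The estimate is made for the truncated expansions [f M]: with [a] the norm of the coefficients,
    the leading part has norm exactly [c * a], the others together at most [c * q * a]. It passes to
    the limit because [F] is finite. *)
Lemma perturbation_bounds (F : {fset J}) alpha :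
  (c * (1 - q)) ^+ 2 * \sum_(j <- F) alpha j ^+ 2 <= L2norm (comb alpha F) ^+ 2
    <= (c * (1 + q)) ^+ 2 * \sum_(j <- F) alpha j ^+ 2.
Proof.
have /andP[q0 q1] := q01.
set N := \sum_(j <- F) _.
have N0 : 0 <= N by apply: sumr_ge0 => j _; exact: sqr_ge0.
pose a := Num.sqrt N; have a0 : 0 <= a by exact: sqrtr_ge0.
have a2 : a ^+ 2 = N by rewrite sqr_sqrtr.
pose G i : L2 mu := \sum_(j <- F) alpha j *: g i j.
have Ga i : L2norm (G i) <= a.
  by rewrite -ler_sqr ?nnegrE ?L2norm_ge0// a2 gi.
have G0a : L2norm (G 0%N) = a.
  by apply/eqP; rewrite -(@eqrXn2 _ 2) ?L2norm_ge0// a2 g0.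
pose f M : L2 mu := c *: \sum_(i < M.+1) w i *: G i.
have fE M : f M = \sum_(j <- F) alpha j *: (c *: \sum_(i < M.+1) w i *: g i j).
  rewrite /f /G; under [RHS]eq_bigr => j _.
    rewrite scalerA mulrC -scalerA scaler_sumr; over.
  rewrite -scaler_sumr exchange_big/=; congr (_ *: _); apply: eq_bigr => i _.
  by rewrite scaler_sumr; apply: eq_bigr => j _; rewrite !scalerA mulrC.
have tail M : L2norm (\sum_(i < M) w i.+1 *: G i.+1) <= q * a.
  apply: (le_trans (L2norm_sum _ _)).
  apply: (@le_trans _ _ (\sum_(i < M) w i.+1 * a)).
    by apply: ler_sum => i _; rewrite L2normZ ger0_norm// ler_wpM2l.
  by rewrite -mulr_suml ler_wpM2r.
have fS M : f M = c *: G 0%N + c *: \sum_(i < M) w i.+1 *: G i.+1.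
  by rewrite /f big_ord_recl/= w0 scale1r scalerDr.
have fub M : L2norm (f M) <= c * (1 + q) * a.
  rewrite fS (le_trans (L2normD _ _))// !L2normZ (ger0_norm (ltW c0)) G0a.
  by rewrite -mulrDr -mulrA ler_pM2l// mulrDl mul1r lerD2l.
have flb M : c * (1 - q) * a <= L2norm (f M).
  have h : L2norm (c *: G 0%N) <= L2norm (f M) + L2norm (c *: \sum_(i < M) w i.+1 *: G i.+1).
    by rewrite -[X in L2norm X <= _](addrK (c *: \sum_(i < M) w i.+1 *: G i.+1)) -fS -(L2normN (c *: \sum_(i < M) _)) L2normD.
  move: h; rewrite !L2normZ (ger0_norm (ltW c0)) G0a => h.
  have := tail M; rewrite -(ler_pM2l c0) => h2.
  by rewrite mulrBr mulr1 mulrBl -!mulrA; lra.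
have cf : L2norm (f M) @[M --> \oo] --> L2norm (comb alpha F).
  have h : \sum_(j <- F) `|alpha j| * L2norm (phi j - c *: \sum_(i < M.+1) w i *: g i j)
      @[M --> \oo] --> 0.
    apply: cvg_sum0 => j; rewrite -(mulr0 `|alpha j|).
    by apply: cvgM; [exact: cvg_cst|exact: gphi].
  apply/cvgrPdist_lt => e e0; move/cvgrPdist_lt : h => /(_ _ e0).
  apply: filterS => M; rewrite sub0r normrN => /(le_lt_trans (ler_norm _)).
  apply: le_lt_trans; apply: (le_trans (L2norm_dist _ _)).
  rewrite fE /comb -sumrB (le_trans (L2norm_sum _ _))//.
  by apply: ler_sum => j _; rewrite -scalerBr L2normZ.
have qc : 0 <= c * (1 - q) by rewrite mulr_ge0 ?subr_ge0// ltW.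
have qc' : 0 <= c * (1 + q) by rewrite mulr_ge0 ?addr_ge0// ltW.
rewrite -a2 -!exprMn !lerXn2r ?nnegrE ?L2norm_ge0 ?(mulr_ge0 qc) ?(mulr_ge0 qc')//.
  by apply: (ler_cvg_to cf (cvg_cst _)); exact: nearW.
by apply: (ler_cvg_to (cvg_cst _) cf); exact: nearW.
Qed.

(** In the application [s] is [1] or a sign for the waves, and [lamR] for the higher harmonics of
    the constant function. *)
Hypothesis g_closed : forall i j, exists j' (s : R), `|s| <= 1 /\ g i j = s *: g 0%N j'.

Lemma perturbation_span j : near_span 0 (g 0%N j).
Proof.
have /andP[q0 q1] := q01.
have key n : forall j, near_span (q ^+ n) (g 0%N j).
  elim: n => [|n IH] {}j.
    rewrite expr0; apply: near_span_le (near_span_norm _).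
    have := g0 [fset j]%fset (fun=> 1); rewrite !big_seq_fset1 scale1r expr1n => h.
    by rewrite -(@ler_pXn2r _ 2) ?nnegrE ?L2norm_ge0// h expr1n.
  have IHi i : near_span (q ^+ n) (g i j).
    have [j' [s [s1 ->]]] := g_closed i j.
    apply: near_span_le (near_spanZ s (IH j')).
    by rewrite ler_piMl// exprn_ge0.
  apply: near_span_lim => e e0.
  have ce0 : 0 < c * e by rewrite mulr_gt0.
  move/cvgrPdist_lt : (gphi j) => /(_ _ ce0)[M _ /(_ M (leqnn _))] /=.
  rewrite sub0r normrN ger0_norm ?L2norm_ge0// => h.
  (* The truncated expansion of [phi j] is solved for its leading term: [phi j] is at distance [0],
     and the other harmonics contribute at most [q * q^n]. *)
  exists (c^-1 *: phi j - \sum_(i < M) w i.+1 *: g i.+1 j).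
    rewrite -(ltr_pM2l c0) -{1}(ger0_norm (ltW c0)) -L2normZ.
    apply: le_lt_trans h; rewrite [leRHS]L2normB.
    rewrite big_ord_recl w0 scale1r opprB addrA scalerBr.
    by rewrite [c *: (c^-1 *: _)]scalerA divff ?gt_eqF// scale1r.
  have -> : q ^+ n.+1 = `|c^-1| * 0 + q * q ^+ n by rewrite mulr0 add0r exprS.
  apply: near_spanD; first exact/near_spanZ/near_span_phi.
  rewrite -sumrN; apply: (@near_span_le (\sum_(i < M) w i.+1 * q ^+ n)).
    by rewrite -mulr_suml ler_wpM2r// exprn_ge0.
  apply: near_span_sum => i; rewrite -scaleNr.
  by have := near_spanZ (- w i.+1) (IHi i.+1); rewrite normrN ger0_norm.
apply: near_span_inf => e e0; rewrite add0r.
have : q ^+ n @[n --> \oo] --> (0 : R) by apply: cvg_expr; rewrite ger0_norm.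
move=> /cvgrPdist_lt /(_ _ e0)[n _ /(_ n (leqnn _))] /=.
rewrite sub0r normrN ger0_norm ?exprn_ge0// => /ltW qe.
exact: near_span_le qe (key n j).
Qed.

End perturbation.

End riesz_abstract.

(** * Integration over the cube *)

Section cube_integral.
Variable R : realType.
Local Notation RT := (measurableTypeR R).

Lemma integral_mrestr d (T : measurableType d) (mu : {measure set T -> \bar R})
    (D : set T) (mD : measurable D) (f : T -> \bar R) :
  (mrestr mu mD).-integrable setT f ->
  (\int[mrestr mu mD]_x f x = \int[mu]_(x in D) f x)%E.
Proof.
move=> fi; transitivity (\int[mrestr mu mD]_(x in setT `\` ~` D) f x)%E.
  apply: negligible_integral => //; first exact: measurableC.
  by rewrite /= /mrestr setICl measure0.
rewrite setTD setCK; apply: eq_measure_integral => A mA AD.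
by rewrite /= /mrestr setIidl.
Qed.

Lemma cube_cons n x (t : n.-tuple RT) :
  unit_cube (tuple_cons (x, t)) <-> 0 < x < 1 /\ unit_cube t.
Proof.
split=> [h|[x01 h] i].
  split; first exact: (h ord0).
  by move=> i; have := h (lift ord0 i); rewrite tnthS.
by case: (unliftP ord0 i) => [j ->|->//]; rewrite tnthS.
Qed.

(** The frequency is a function rather than a tuple, so that sums, multiples and removal of the
    first entry are plain lambda terms. *)
Definition phase n (k : 'I_n -> int) (x : n.-tuple RT) : R :=
  \sum_(i < n) (k i)%:~R * tnth x i.

Lemma phase_cons n (k : 'I_n.+1 -> int) x (t : n.-tuple RT) :
  phase k (tuple_cons (x, t)) = (k ord0)%:~R * x + phase (fun i => k (lift ord0 i)) t.
Proof.
rewrite /phase big_ord_recl; congr (_ + _).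
by apply: eq_bigr => i _; rewrite tnthS.
Qed.

Lemma measurable_phase n (k : 'I_n -> int) : measurable_fun setT (phase k).
Proof.
by apply: measurable_sum => i; apply: measurable_funM => //; exact: measurable_tnth.
Qed.

Lemma measurable_cos_phase n a (k : 'I_n -> int) :
  measurable_fun setT (fun x => cos (a + pi *+ 2 * phase k x)).
Proof.
apply: (measurableT_comp (f := cos)).
  by apply: continuous_measurable_fun; exact: continuous_cos.
by apply: measurable_funD => //; apply: measurable_funM => //; exact: measurable_phase.
Qed.

Lemma integral_cos_itv (a : R) (m : int) : m != 0 ->
  (\int[lebesgue_measure]_(x in `]0%R, 1%R[) (cos (a + pi *+ 2 * (m%:~R * x)))%:E = 0)%E.
Proof.
move=> m0; pose b : R := pi *+ 2 * m%:~R.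
have b0 : b != 0 by rewrite mulf_neq0 ?intr_eq0// mulrn_eq0/= gt_eqF ?pi_gt0.
have dF (x : R) : is_derive x 1 (fun x : R => b^-1 * sin (a + b * x)) (cos (a + b * x)).
  have h : is_derive x 1 (sin \o (cst a + b \*: id)) (cos (a + b * x) * b).
    apply: is_derive1_comp; apply: is_derive_eq.
    by rewrite add0r /GRing.scale/= mulr1.
  have := is_derive_cstM b^-1 h.
  by move/is_derive_eq; apply; rewrite mulrCA mulVf// mulr1.
have cf : continuous (fun x : R => cos (a + b * x)).
  move=> x; apply: continuous_comp; last exact: continuous_cos.
  by apply: continuousD; [exact: cvg_cst|exact: mulrl_continuous].
transitivity (\int[lebesgue_measure]_(x in `[0%R, 1%R]) (cos (a + b * x))%:E)%E.
  have mcos (D : set RT) : measurable_fun D (fun x => (cos (a + pi *+ 2 * (m%:~R * x)))%:E).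
    apply/measurable_EFinP/measurable_funTS.
    rewrite (_ : (fun x => _) = (fun x : R => cos (a + b * x))).
      exact: continuous_measurable_fun.
    by apply/funext => x; rewrite /b mulrA.
  rewrite integral_itv_bndo_bndc; last exact: mcos.
  rewrite integral_itv_obnd_cbnd; last exact: mcos.
  by apply: eq_integral => x _; rewrite /b mulrA.
rewrite (@continuous_FTC2 _ _ (fun x : R => b^-1 * sin (a + b * x)))//.
- rewrite mulr0 addr0 mulr1 -EFinB -mulrBr.
  suff -> : sin (a + b) = sin a by rewrite subrr mulr0.
  have := cosDz m (a - pi / 2); rewrite cosBpihalf => <-.
  by rewrite addrAC cosBpihalf /b mulrC.
- exact: continuous_subspaceT.
- split.
  + by move=> x _; case: (dF x).
  + apply: cvg_at_right_filter; have [/derivable1_diffP/differentiable_continuous] := dF 0; exact.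
  + apply: cvg_at_left_filter; have [/derivable1_diffP/differentiable_continuous] := dF 1; exact.
- by move=> x _; rewrite derive1E; case: (dF x).
Qed.

Lemma bounded_cube_integrable n (u : n.-tuple RT -> R) (c : R) : measurable_fun setT u ->
  (forall x, `|u x| <= c) -> (lebesgue_tuple R n).-integrable setT
    ((EFin \o u) \_ (unit_cube (n := n))).
Proof.
move=> mu uc.
have mD := @measurable_unit_cube R n.
rewrite -integrable_mkcond//.
apply/integrableP; split; first exact/measurable_EFinP/measurable_funTS.
apply: (@le_lt_trans _ _ (\int[lebesgue_tuple R n]_(x in unit_cube (n := n)) (cst c%:E x))%E).
  apply: ge0_le_integral => //=.
  - by apply/measurable_EFinP/measurableT_comp => //; exact: measurable_funTS.
  - by move=> x _; rewrite lee_fin.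
by rewrite integral_cst// [X in (_ * X)%E](@lebesgue_unit_cube R n) mule1 ltry.
Qed.

(** Fubini in the first coordinate. If another frequency is nonzero, the inner integral vanishes by
    induction, the first coordinate being absorbed into [a]; otherwise the integrand depends on the
    first coordinate only and runs through full periods. *)
Lemma integral_cos_cube n a (k : 'I_n -> int) : (exists i, k i != 0) ->
  (\int[lebesgue_tuple R n]_(x in unit_cube (n := n))
     (cos (a + pi *+ 2 * phase k x))%:E = 0)%E.
Proof.
elim: n => [|n IH] in a k *; first by case=> -[].
move=> kn0.
have mD := @measurable_unit_cube R n.+1; have mDn := @measurable_unit_cube R n.
pose f : n.+1.-tuple RT -> \bar R :=
  (EFin \o (fun x => cos (a + pi *+ 2 * phase k x))) \_ (unit_cube (n := n.+1)).
have fi : (lebesgue_tuple R n.+1).-integrable setT f.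
  by apply: (@bounded_cube_integrable _ _ 1); [exact: measurable_cos_phase|move=> x; exact: cos_max].
rewrite integral_mkcond -/f.
pose mu : {measure set (RT * n.-tuple RT) -> \bar R} :=
  [the measure _ _ of (lebesgue_measure \x lebesgue_tuple R n)%E].
(* The same measure, presented as a pushforward so that the change of variables applies. *)
pose pm := measure_function_pushforward__canonical__measure_function_Measure
  mu (@measurable_tuple_cons R n).
have e1 (h : n.+1.-tuple RT -> \bar R) :
  (\int[lebesgue_tuple R n.+1]_x h x = \int[pm]_x h x)%E.
  exact: eq_measure_integral.
have mf : measurable_fun setT f := measurable_int _ fi.
have fci : mu.-integrable setT (f \o @tuple_cons R n).
  apply/integrableP; split; first exact: (measurableT_comp mf (@measurable_tuple_cons R n)).
  have /integrableP[_] := fi.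
  rewrite e1 (ge0_integral_pushforward (@measurable_tuple_cons R n))//; last exact: measurableT_comp.
rewrite e1 (integral_pushforward (@measurable_tuple_cons R n))// preimage_setT.
rewrite -[LHS]/(\int[mu]_z (f \o @tuple_cons R n) z)%E -(integral12_prod_meas1 fci).
have fE x t : (f \o @tuple_cons R n) (x, t) =
    if 0 < x < 1 then ((EFin \o (fun t => cos (a + pi *+ 2 * ((k ord0)%:~R * x) +
      pi *+ 2 * phase (fun i => k (lift ord0 i)) t))) \_ (unit_cube (n := n))) t else 0%E.
  rewrite /= /f !patchE; case: (boolP (0 < x < 1)) => x01.
    have -> : (tuple_cons (x, t) \in unit_cube (n := n.+1)) = (t \in unit_cube (n := n)).
      by apply/idP/idP; rewrite !inE cube_cons; [case|].
    by rewrite /= phase_cons mulrDr addrA.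
  by rewrite ifF//; apply/negP; rewrite inE cube_cons => -[x01' _]; move: x01; rewrite x01'.
have FE x : fubini_F (lebesgue_tuple R n) (f \o @tuple_cons R n) x =
    if 0 < x < 1 then (\int[lebesgue_tuple R n]_(t in unit_cube (n := n))
      (cos (a + pi *+ 2 * ((k ord0)%:~R * x) +
      pi *+ 2 * phase (fun i => k (lift ord0 i)) t))%:E)%E else 0%E.
  rewrite /fubini_F; under eq_integral do rewrite fE.
  by case: ifPn => _; [rewrite [RHS]integral_mkcond|rewrite integral0].
under eq_integral do rewrite FE.
have [k0|k0] := pselect (exists i, k (lift ord0 i) != 0).
  rewrite (eq_integral (cst 0%E)) ?integral0// => x _; rewrite IH//.
  by case: ifP.
have k'0 i : k (lift ord0 i) = 0.
  by apply/eqP/negPn/negP => ki; apply: k0; exists i.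
have k00 : k ord0 != 0.
  case: kn0 => i; case: (unliftP ord0 i) => [j ->|->//].
  by rewrite k'0 eqxx.
transitivity (\int[lebesgue_measure]_x ((fun x => (cos (a + pi *+ 2 * ((k ord0)%:~R * x)))%:E) \_ `]0%R, 1%R[) x)%E.
  apply: eq_integral => x _; rewrite patchE mem_setE in_itv/=; case: ifPn => // x01.
  under eq_integral => t _.
    rewrite /phase big1 ?mulr0 ?addr0; last by move=> i _; rewrite k'0 mul0r.
    over.
  rewrite (integral_cst _ mDn) -[RHS]mule1; congr (_ * _)%E.
  exact: lebesgue_unit_cube.
by rewrite -integral_mkcond integral_cos_itv.
Qed.

Local Notation mu n := (cube_measure R n).

Lemma cube_measure_integral n (u : n.-tuple RT -> R) c : measurable_fun setT u ->
  (forall x, `|u x| <= c) ->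
  \int[mu n]_x u x = fine (\int[lebesgue_tuple R n]_(x in unit_cube (n := n)) (u x)%:E).
Proof.
move=> mu_ uc; rewrite /Rintegral /cube_measure integral_mrestr//.
apply: (@le_integrable _ _ _ _ _ _ _ (cst c%:E)) => //.
- exact/measurable_EFinP.
- move=> x _ /=; rewrite lee_fin (le_trans (uc x))// ler_norm//.
apply/integrableP; split; first exact: measurable_cst.
by rewrite integral_cst// [X in (_ * X)%E](@cube_measureT R n) mule1 ltry.
Qed.

Lemma cube_integral_cos n a (k : 'I_n -> int) : (exists i, k i != 0) ->
  \int[mu n]_x cos (a + pi *+ 2 * phase k x) = 0.
Proof.
move=> k0; rewrite (@cube_measure_integral _ _ 1); first by rewrite integral_cos_cube.
- exact: measurable_cos_phase.
- by move=> x; exact: cos_max.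
Qed.

Lemma cube_integrable_cos n a (k : 'I_n -> int) :
  (mu n).-integrable setT (EFin \o (fun x => cos (a + pi *+ 2 * phase k x))).
Proof.
apply: (@le_integrable _ _ _ _ _ _ _ (cst 1%E)) => //.
- by apply/measurable_EFinP; exact: measurable_cos_phase.
- by move=> x _ /=; rewrite lee_fin (le_trans (cos_max _))// ler_norm.
apply/integrableP; split; first exact: measurable_cst.
by rewrite integral_cst// [X in (_ * X)%E](@cube_measureT R n) mule1 ltry.
Qed.

Lemma dotzE n (k : n.-tuple int) x : dotz k x = phase (tnth k) x.
Proof. by []. Qed.

Lemma lex_pos_neq0 n (k : n.-tuple int) : lex_pos k -> exists i, tnth k i != 0.
Proof. by move=> /existsP[i /andP[k0 _]]; exists i; rewrite gt_eqF. Qed.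

(** At the earlier of the two leading positions the other vector is zero, and at a common one both
    entries are positive. Thus the frequency [k + l] from a product-to-sum formula never
    vanishes. *)
Lemma lex_pos_add n (k l : n.-tuple int) (a b : nat) : (0 < a)%N ->
  lex_pos k -> lex_pos l -> exists i, a%:Z * tnth k i + b%:Z * tnth l i != 0.
Proof.
move=> a0 /existsP[i /andP[ki /forallP kj]] /existsP[i' /andP[li /forallP lj]].
have a0' : 0 < a%:Z by [].
have [ii'|i'i|/ord_inj ii'] := ltngtP i i'.
- exists i; have := lj i; rewrite ii'/= => /eqP->.
  by rewrite mulr0 addr0 mulf_neq0// gt_eqF.
- case: b => [|b].
    by exists i; rewrite mul0r addr0 mulf_neq0// gt_eqF.
  exists i'; have := kj i'; rewrite i'i/= => /eqP->.
  by rewrite mulr0 add0r mulf_neq0// gt_eqF.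
- exists i; rewrite -ii' in li.
  by rewrite gt_eqF// ltr_wpDr ?mulr_gt0// mulr_ge0// ltW.
Qed.

Lemma lex_pos_scale n (k : n.-tuple int) (a : nat) : (0 < a)%N -> lex_pos k ->
  lex_pos [tuple a%:Z * tnth k i | i < n].
Proof.
move=> a0 /existsP[i /andP[ki /forallP kj]]; apply/existsP; exists i.
rewrite tnth_mktuple mulr_gt0//=; apply/forallP => j; rewrite tnth_mktuple.
by apply/implyP => ji; have := kj j; rewrite ji/= => /eqP->; rewrite mulr0.
Qed.

(* [b = 0] and [b = pi / 2] give the harmonics of [tri_cos] and [tri_sin]. *)
Definition wave n (i : nat) (k : n.-tuple int) (b : R) (x : n.-tuple RT) : R :=
  cos ((i.*2).+1%:R * (dotz k x * (pi *+ 2) - b)).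

Lemma waveE n i (k : n.-tuple int) b x : wave i k b x =
  cos (- ((i.*2).+1%:R * b) + pi *+ 2 * phase (fun j => (i.*2).+1%:Z * tnth k j) x).
Proof.
rewrite /wave dotzE; congr cos; rewrite mulrBr addrC; congr (_ + _).
rewrite [RHS]mulrC mulrA; congr (_ * _); rewrite /phase mulr_sumr.
by apply: eq_bigr => j _; rewrite intrM mulrA.
Qed.

Lemma measurable_wave n i (k : n.-tuple int) b : measurable_fun setT (wave i k b).
Proof.
rewrite (_ : wave i k b = (fun x =>
  cos (- ((i.*2).+1%:R * b) + pi *+ 2 * phase (fun j => (i.*2).+1%:Z * tnth k j) x))).
  exact: measurable_cos_phase.
by apply/funext => x; exact: waveE.
Qed.

Lemma integral_wave n i (k : n.-tuple int) b : lex_pos k -> \int[mu n]_x wave i k b x = 0.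
Proof.
move=> /lex_pos_neq0[j kj]; under eq_Rintegral do rewrite waveE.
by apply: cube_integral_cos; exists j; rewrite mulf_neq0.
Qed.

(** The product has frequencies [m (k - l)] and [m (k + l)]; the latter is never zero, the former
    only for [k = l]. General phases treat cosine and sine waves at once: for [0] and [pi/2] the
    value vanishes because [m] is odd. *)
Lemma integral_waveM n i (k l : n.-tuple int) b b' : lex_pos k -> lex_pos l ->
  \int[mu n]_x (wave i k b x * wave i l b' x) =
  if k == l then cos ((i.*2).+1%:R * (b - b')) / 2 else 0.
Proof.
move=> k0 l0; set m := (i.*2).+1.
pose u x := cos (- (m%:R * (b - b')) + pi *+ 2 *
  phase (fun j => m%:Z * tnth k j - m%:Z * tnth l j) x).
pose v x := cos (- (m%:R * (b + b')) + pi *+ 2 *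
  phase (fun j => m%:Z * tnth k j + m%:Z * tnth l j) x).
have phaseD (s t : 'I_n -> int) x : phase (fun j => s j + t j) x = phase s x + phase t x.
  by rewrite /phase -big_split; apply: eq_bigr => j _; rewrite intrD mulrDl.
have phaseB (s t : 'I_n -> int) x : phase (fun j => s j - t j) x = phase s x - phase t x.
  by rewrite /phase -sumrB; apply: eq_bigr => j _; rewrite intrD mulrDl intrN mulNr.
have uv x : wave i k b x * wave i l b' x = 2^-1 * (u x + v x).
  rewrite !waveE -/m /u /v phaseB phaseD.
  set p := phase _ x; set q := phase _ x.
  have -> : - (m%:R * (b - b')) + pi *+ 2 * (p - q) =
    (- (m%:R * b) + pi *+ 2 * p) - (- (m%:R * b') + pi *+ 2 * q) by ring.
  have -> : - (m%:R * (b + b')) + pi *+ 2 * (p + q) =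
    (- (m%:R * b) + pi *+ 2 * p) + (- (m%:R * b') + pi *+ 2 * q) by ring.
  move: (- (m%:R * b) + pi *+ 2 * p) (- (m%:R * b') + pi *+ 2 * q) => A B.
  by rewrite cosB cosD; field.
under eq_Rintegral do rewrite uv.
have iu : (mu n).-integrable setT (EFin \o u) by exact: cube_integrable_cos.
have iv : (mu n).-integrable setT (EFin \o v) by exact: cube_integrable_cos.
rewrite RintegralZl//; last by have := integrableD measurableT iu iv; apply: eq_integrable.
rewrite RintegralD//.
have -> : \int[mu n]_x v x = 0.
  by apply: cube_integral_cos; exact: lex_pos_add.
case: ifPn => [/eqP kl|kl].
  rewrite addr0 mulrC; congr (_ / 2).
  transitivity (\int[mu n]_x cst (cos (m%:R * (b - b'))) x).
    by apply: eq_Rintegral => x _; rewrite /u phaseB kl subrr mulr0 addr0 cosN.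
  by rewrite Rintegral_cst// (_ : fine _ = 1) ?mulr1// [X in fine X](@cube_measureT R n).
rewrite (_ : \int[mu n]_x u x = 0) ?addr0 ?mulr0//.
apply: cube_integral_cos; apply: contrapT => h; move/negP: kl; apply.
apply/eqP/eq_from_tnth => j; apply/eqP; rewrite -subr_eq0.
apply/negPn/negP => klj; apply: h; exists j.
by rewrite -mulrBr mulf_neq0.
Qed.

End cube_integral.

(** * Harmonics of the system *)

Section system.
Variables (R : realType) (n : nat).
Local Notation RT := (measurableTypeR R).
Local Notation mu := (cube_measure R n).
Local Notation J := (option (freq n + freq n)).

Definition cR : R := 4 * Num.sqrt 6 / pi ^+ 2.
Definition qR : R := pi ^+ 2 / 8 - 1.
Definition wR (i : nat) : R := (i.*2).+1%:R ^- 2.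

(* The weights of the constant function in the harmonics [i > 0] are chosen so
   that [cR * (1 + \sum_(i > 0) wR i * lamR)] is [1]. *)
Definition lamR : R := (1 - cR) / (cR * qR).

Lemma pi_sq_bounds : 98 / 10 <= (pi : R) ^+ 2 <= 99 / 10.
Proof.
have /andP[p1 p2] := pi_bounds R; have p0 := pi_gt0 R.
move: (pi) p1 p2 p0 => p p1 p2 p0; apply/andP; split; nra.
Qed.

Lemma qR_bounds : 0 < qR < 1.
Proof. by have := pi_sq_bounds; rewrite /qR => /andP[? ?]; apply/andP; split; lra. Qed.

Lemma cR_gt0 : 0 < cR.
Proof. by rewrite /cR divr_gt0 ?mulr_gt0 ?sqrtr_gt0 ?exprn_gt0 ?pi_gt0. Qed.

Lemma cR_sq : (cR * (1 + qR)) ^+ 2 = 3 / 2.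
Proof.
have -> : cR * (1 + qR) = Num.sqrt 6 / 2.
  rewrite /cR /qR; have := lt0r_neq0 (pi_gt0 R); move: (pi) => p p0; by field.
by rewrite exprMn sqr_sqrtr//; field.
Qed.

(** [cR^2] is [96 / pi^4], only slightly below [1]; the bound [pi^2 >= 9.8] just suffices, as
    [9.8^2 = 96.04]. *)
Lemma cR_le1 : cR <= 1.
Proof.
rewrite -(@ler_pXn2r _ 2) ?nnegrE ?(ltW cR_gt0)// expr1n.
rewrite /cR exprMn exprMn sqr_sqrtr// exprVn.
have /andP[p1 _] := pi_sq_bounds.
rewrite ler_pdivrMr ?mul1r; last by rewrite !exprn_gt0 ?pi_gt0.
move: (pi ^+ 2) p1 => p p1; nra.
Qed.

Lemma cR_qR_ge1 : 1 <= cR * (1 + qR).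
Proof.
have /andP[q0 q1] := qR_bounds.
rewrite -(@ler_pXn2r _ 2) ?nnegrE// ?expr1n ?cR_sq; first by lra.
by rewrite mulr_ge0 ?(ltW cR_gt0)// addr_ge0// ltW.
Qed.

Lemma lamR_bounds : 0 <= lamR <= 1.
Proof.
have /andP[q0 q1] := qR_bounds; have cq0 : 0 < cR * qR by rewrite mulr_gt0 ?cR_gt0.
rewrite /lamR divr_ge0 ?subr_ge0 ?cR_le1 ?(ltW cq0)//=.
by rewrite ler_pdivrMr// mul1r; have := cR_qR_ge1; rewrite mulrDr mulr1; lra.
Qed.

Definition harm_fun (i : nat) (j : J) (x : n.-tuple RT) : R :=
  match j with
  | None => if i == 0%N then 1 else lamR
  | Some (inl k) => Num.sqrt 2 * wave i (val k) 0 x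
  | Some (inr k) => Num.sqrt 2 * wave i (val k) (pi / 2) x
  end.

Lemma measurable_harm_fun i j : measurable_fun setT (harm_fun i j).
Proof.
case: j => [[k|k]|] /=; last exact: measurable_cst.
- by apply: measurable_funM => //; exact: measurable_wave.
- by apply: measurable_funM => //; exact: measurable_wave.
Qed.

Lemma sqrt2_ge1 : 1 <= Num.sqrt 2 :> R.
Proof. by rewrite -[leLHS](@sqrtr1 R) ler_wsqrtr// ler1n. Qed.

Lemma harm_fun_bounded i j x : `|harm_fun i j x| <= Num.sqrt 2.
Proof.
case: j => [[k|k]|] /=.
- by rewrite normrM ger0_norm// ler_piMr// cos_max.
- by rewrite normrM ger0_norm// ler_piMr// cos_max.
- apply: le_trans sqrt2_ge1; have /andP[l0 l1] := lamR_bounds.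
  by case: ifP => _; rewrite ger0_norm.
Qed.

Lemma cube_measure_lty : (mu setT < +oo)%E.
Proof. by rewrite cube_measureT ltry. Qed.

Definition harm i j : L2 mu := Lfun_Sub (lee1n 2)
  (L2_bounded (measurable_harm_fun i j) cube_measure_lty (harm_fun_bounded i j)).

Lemma dot_harm i j j' : dot (harm i j) (harm i j') =
  if j == j' then (if j is None then (if i == 0%N then 1 else lamR ^+ 2) else 1) else 0.
Proof.
have s2 : Num.sqrt 2 * Num.sqrt 2 = 2 :> R by rewrite -expr2 sqr_sqrtr.
have w1 i' k b : lex_pos k -> forall r : R,
    \int[mu]_x (r * (Num.sqrt 2 * wave i' k b x)) = 0.
  move=> k0 r; have iw : mu.-integrable setT (EFin \o (fun x => wave i' k b x)).
    apply: eq_integrable (cube_integrable_cos _ _) => //; last first.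
      by move=> x _ /=; rewrite waveE.
  under eq_Rintegral do rewrite mulrA.
  by rewrite RintegralZl// integral_wave// mulr0.
have w2 k l b b' : lex_pos k -> lex_pos l ->
    \int[mu]_x (Num.sqrt 2 * wave i k b x * (Num.sqrt 2 * wave i l b' x)) =
    if k == l then cos ((i.*2).+1%:R * (b - b')) else 0.
  move=> k0 l0; have e x : Num.sqrt 2 * wave i k b x * (Num.sqrt 2 * wave i l b' x) =
    2 * (wave i k b x * wave i l b' x) by rewrite mulrACA s2.
  under eq_Rintegral do rewrite e.
  rewrite RintegralZl//.
    by rewrite integral_waveM//; case: ifP => _; [field|rewrite mulr0].
  have mw b'' m : measurable_fun setT (wave i m b'' : n.-tuple RT -> R) := measurable_wave i m b''.
  have bw b'' m (x : n.-tuple RT) : `|wave i m b'' x| <= Num.sqrt 2.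
    by apply: le_trans sqrt2_ge1; exact: cos_max.
  have L b'' m := L2_bounded (mw b'' m) cube_measure_lty (bw b'' m).
  by have /Lfun1_integrable := Lfun2_mul_Lfun1 (L b k) (L b' l).
rewrite /dot; case: j j' => [[k|k]|] [[l|l]|] /=.
- rewrite w2 ?(valP k) ?(valP l)// subrr mulr0 cos0.
  by rewrite (inj_eq Some_inj) (inj_eq inl_inj) -(inj_eq val_inj).
- rewrite w2 ?(valP k) ?(valP l)// sub0r mulrN cosN cos_odd_pihalf.
  by case: ifP.
- by under eq_Rintegral do rewrite mulrC; rewrite w1// (valP k).
- rewrite w2 ?(valP k) ?(valP l)// subr0 cos_odd_pihalf.
  by case: ifP.
- rewrite w2 ?(valP k) ?(valP l)// subrr mulr0 cos0.
  by rewrite (inj_eq Some_inj) (inj_eq inr_inj) -(inj_eq val_inj).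
- by under eq_Rintegral do rewrite mulrC; rewrite w1// (valP k).
- by rewrite w1// (valP l).
- by rewrite w1// (valP l).
- rewrite Rintegral_cst// [X in fine X](@cube_measureT R n) mulr1.
  by case: ifP => _; rewrite ?mulr1// expr2.
Qed.

Lemma L2norm_harm_sum i (F : {fset J}) alpha :
  L2norm (\sum_(j <- F) alpha j *: harm i j) ^+ 2 =
  \sum_(j <- F) alpha j ^+ 2 * (if j is None then (if i == 0%N then 1 else lamR ^+ 2) else 1).
Proof.
rewrite L2norm_sq dot_suml; apply: eq_big_seq => j jF.
rewrite dotZl dot_sumr (big_fsetD1 j)//= big1_seq ?addr0.
  by rewrite dotC dotZl dot_harm eqxx mulrA -expr2.
move=> j' /= /fsetD1P[j'j _]; rewrite dotC dotZl dot_harm.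
by rewrite (negPf j'j) mulr0.
Qed.

Lemma wR_sum M : \sum_(i < M) wR i = cos_partial M 0.
Proof. by apply: eq_bigr => i _; rewrite mulr0 cos0 mul1r. Qed.

Lemma wR_sumS M : \sum_(i < M) wR i.+1 = cos_partial M.+1 0 - 1.
Proof. by rewrite -wR_sum big_ord_recl /wR/= expr1n invr1 addrC addKr. Qed.

Lemma wR_ge0 i : 0 <= wR i.
Proof. by rewrite invr_ge0. Qed.

(** The partial sums increase, and by the expansion at [0] they approach [pi^2/8]; [qR] is that
    limit without its first term. *)
Lemma wR_sum_le M : \sum_(i < M) wR i.+1 <= qR.
Proof.
rewrite wR_sumS /qR lerB//; apply: (@le_forall_divn _ _ _ 1) => N N0.
have h : cos_partial M.+1 0 <= cos_partial (maxn M.+1 N) 0 :> R.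
  rewrite -!wR_sum -!(big_mkord xpredT) (big_cat_nat (n := M.+1) (leq0n _) (leq_maxl _ _))/=.
  by rewrite lerDl; apply: sumr_ge0 => i _; exact: wR_ge0.
have m0 : (0 < maxn M.+1 N)%N by rewrite leq_max.
apply: (le_trans h); have := triangle_expansion0 R m0.
rewrite ler_norml => /andP[_]; rewrite lerBlDr => /le_trans; apply.
rewrite addrC lerD// ?div1r.
  by rewrite le_eqVlt; apply/orP; left; apply/eqP; move: (pi) => p; field.
rewrite lef_pV2 ?posrE ?mulr_gt0 ?ltr0n//.
apply: (@le_trans _ _ (maxn M.+1 N)%:R); first by rewrite ler_nat leq_maxr.
by rewrite ler_peMl// ler1n.
Qed.

(** For the waves this is the triangular expansion, with [cR * sqrt 2 = sqrt 3 * 8 / pi^2] and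
    [sqrt 3 <= 2]. For the constant function the choice of [lamR] makes the error [cR * lamR] times
    the tail of the weights. *)
Lemma harm_sum_bound M j x :
  `|Rsys_fun j x - cR * \sum_(i < M.+1) wR i * harm_fun i j x| <= 2 / M.+1%:R.
Proof.
have s32 : Num.sqrt 3 <= 2 :> R.
  have -> : 2 = Num.sqrt (2 ^+ 2) :> R by rewrite sqrtr_sqr ger0_norm.
  by apply: ler_wsqrtr; lra.
have cs : cR * Num.sqrt 2 = Num.sqrt 3 * (8 / pi ^+ 2).
  rewrite /cR -!mulrA (mulrC _ (Num.sqrt 2)) mulrA.
  have -> : 4 * Num.sqrt 6 * (Num.sqrt 2 / pi ^+ 2) = 4 * (Num.sqrt 6 * Num.sqrt 2) / pi ^+ 2 :> R by rewrite !mulrA.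
  have -> : Num.sqrt 6 * Num.sqrt 2 = 2 * Num.sqrt 3 :> R.
    rewrite -sqrtrM// (_ : 6 * 2 = 2 ^+ 2 * 3); last by ring.
    by rewrite sqrtrM ?sqrtr_sqr ?ger0_norm// exprn_ge0.
  by rewrite mulrA (_ : 4 * 2 = 8) ?[8 * _]mulrC ?mulrA//; ring.
have wavesum k b : cR * \sum_(i < M.+1) wR i * (Num.sqrt 2 * wave i k b x) =
    Num.sqrt 3 * (8 / pi ^+ 2 * cos_partial M.+1 (dotz k x * (pi *+ 2) - b)).
  rewrite [RHS]mulrA -cs -[RHS]mulrA; congr (_ * _); rewrite /cos_partial mulr_sumr.
  by apply: eq_bigr => i _; rewrite mulrCA; congr (_ * _); exact: mulrC.
case: j => [[k|k]|] /=.
- rewrite wavesum -mulrBr normrM ger0_norm// subr0 ler_pM//.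
  exact: tri_cos_expansion.
- rewrite wavesum -mulrBr normrM ger0_norm// ler_pM//.
  exact: tri_sin_expansion.
- rewrite big_ord_recl/= /wR/= expr1n invr1 mulr1.
  under eq_bigr do rewrite -/(wR _).
  rewrite -mulr_suml.
  have /andP[q0 q1] := qR_bounds; have c0 := cR_gt0; have c1 := cR_le1.
  have /andP[l0 l1] := lamR_bounds.
  have e : cR * qR * lamR = 1 - cR.
    by rewrite /lamR mulrCA divff ?mulr1// gt_eqF// mulr_gt0.
  have -> : 1 - cR * (1 + (\sum_(i < M) wR i.+1) * lamR) =
      cR * lamR * (qR - \sum_(i < M) wR i.+1).
    by rewrite mulrDr mulr1 opprD addrA -e; ring.
  have h := wR_sum_le M.
  have cl0 : 0 <= cR * lamR by rewrite mulr_ge0 ?(ltW c0).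
  have cl1 : cR * lamR <= 1 by rewrite -[leRHS]mul1r ler_pM// ltW.
  have d0 : 0 <= qR - \sum_(i < M) wR i.+1 by rewrite subr_ge0.
  rewrite ger0_norm; last exact: mulr_ge0.
  apply: (@le_trans _ _ (1 * (qR - \sum_(i < M) wR i.+1))); first by rewrite ler_wpM2r.
  rewrite mul1r.
  have := triangle_expansion0 R (ltn0Sn M).
  rewrite wR_sumS ler_norml => /andP[h2 _].
  have -> : qR - (cos_partial M.+1 0 - 1) = - (cos_partial M.+1 0 - pi / 4 * (pi / 2)).
    by rewrite /qR; move: (cos_partial _ _) => z; move: (pi) => p; field.
  rewrite lerNl; apply: le_trans h2; rewrite lerN2 invfM ler_pM2r ?invr_gt0 ?ltr0n//.
  lra.
Qed.

Lemma L2_le_divn_cvg (u : nat -> L2 mu) C : (forall M, L2norm (u M) <= C / M.+1%:R) ->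
  L2norm (u M) @[M --> \oo] --> 0.
Proof.
move=> uC; apply: (@squeeze_cvgr _ _ _ _ (cst 0) (fun M => C * harmonic M)).
- by apply: nearW => M; rewrite L2norm_ge0/= uC.
- exact: cvg_cst.
- by rewrite -(mulr0 C); apply: cvgM; [exact: cvg_cst|exact: cvg_harmonic].
Qed.

Lemma harm_sum_cvg j :
  L2norm (Rsys R n j - cR *: \sum_(i < M.+1) wR i *: harm i j) @[M --> \oo] --> 0.
Proof.
apply: (@L2_le_divn_cvg _ 2) => M; apply: (L2norm_le_cst (@cube_measureT R n)) => x.
apply: le_trans (harm_sum_bound M j x).
rewrite le_eqVlt; apply/orP; left; apply/eqP; congr `|_|.
rewrite -[LHS]/(Rsys_fun j x - cR * (\sum_(i < M.+1) wR i *: harm i j : L2 mu) x).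
by rewrite L2_sumE.
Qed.

Lemma L2norm_harm0_sum (F : {fset J}) alpha :
  L2norm (\sum_(j <- F) alpha j *: harm 0 j) ^+ 2 = \sum_(j <- F) alpha j ^+ 2.
Proof.
by rewrite L2norm_harm_sum; apply: eq_bigr => -[j|] _; rewrite mulr1.
Qed.

Lemma L2norm_harm_sum_le i (F : {fset J}) alpha :
  L2norm (\sum_(j <- F) alpha j *: harm i j) ^+ 2 <= \sum_(j <- F) alpha j ^+ 2.
Proof.
rewrite L2norm_harm_sum; apply: ler_sum => -[j|] _; first by rewrite mulr1.
have /andP[l0 l1] := lamR_bounds.
by rewrite ler_piMr ?sqr_ge0//; case: ifP => // _; rewrite expr_le1.
Qed.

Lemma wave_scale i (k : n.-tuple int) b (x : n.-tuple RT) :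
  wave 0 [tuple (i.*2).+1%:Z * tnth k j | j < n] b x =
  cos ((i.*2).+1%:R * dotz k x * (pi *+ 2) - b).
Proof.
rewrite /wave mul1r; congr cos; congr (_ * _ - _).
rewrite !dotzE /phase mulr_sumr; apply: eq_bigr => j _.
by rewrite tnth_mktuple intrM mulrA.
Qed.

Lemma harm_closed i j : exists j' (s : R), `|s| <= 1 /\ harm i j = s *: harm 0 j'.
Proof.
pose sc (k : freq n) : freq n := @exist _ (fun k : n.-tuple int => lex_pos k) _ (lex_pos_scale (ltn0Sn i.*2) (valP k)).
case: j => [[k|k]|].
- exists (Some (inl (sc k))), 1; rewrite normr1; split => //.
  apply/LfuneqP => x; rewrite scale1r.
  rewrite -[LHS]/(Num.sqrt 2 * _) -[RHS]/(Num.sqrt 2 * _) wave_scale /wave subr0.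
  by rewrite subr0 mulrA.
(* For [m = 2i+1] the shift by [pi/2] gives [cos (m (t - pi/2)) = (-1)^i * sin (m t)]. *)
- exists (Some (inr (sc k))), ((-1) ^+ i); rewrite normrX normrN1 expr1n; split => //.
  apply/LfuneqP => x.
  rewrite -[LHS]/(Num.sqrt 2 * _) -[RHS]/((-1) ^+ i * (Num.sqrt 2 * _)) wave_scale /wave.
  rewrite [RHS]mulrCA cosBpihalf mulrBr cosB cos_odd_pihalf sin_odd_pihalf mulr0 add0r.
  by congr (_ * _); rewrite mulrC; congr (_ * sin _); rewrite mulrA.
- exists None, (if i == 0%N then 1 else lamR); split.
    by have /andP[l0 l1] := lamR_bounds; case: ifP => _; rewrite ?normr1 ?ger0_norm.
  by apply/LfuneqP => x; rewrite -[RHS]/(_ * 1) mulr1.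
Qed.

Lemma Rsys_bounds (F : {fset J}) alpha :
  (cR * (1 - qR)) ^+ 2 * \sum_(j <- F) alpha j ^+ 2 <= L2norm (comb (Rsys R n) alpha F) ^+ 2
    <= 3 / 2 * \sum_(j <- F) alpha j ^+ 2.
Proof.
have /andP[q0 q1] := qR_bounds.
rewrite -cR_sq; apply: (@perturbation_bounds _ _ _ _ _ _ harm wR) => //.
- exact: cR_gt0.
- by rewrite (ltW q0).
- by rewrite /wR expr1n invr1.
- exact: wR_ge0.
- exact: wR_sum_le.
- exact: L2norm_harm0_sum.
- exact: L2norm_harm_sum_le.
- exact: harm_sum_cvg.
Qed.

Lemma harm0_span j : near_span (Rsys R n) 0 (harm 0 j).
Proof.
have /andP[q0 q1] := qR_bounds.
apply: (@perturbation_span _ _ _ _ _ _ harm wR cR qR) => //.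
- exact: cR_gt0.
- by rewrite (ltW q0).
- by rewrite /wR expr1n invr1.
- exact: wR_ge0.
- exact: wR_sum_le.
- exact: L2norm_harm0_sum.
- exact: harm_sum_cvg.
- exact: harm_closed.
Qed.

End system.

Import HBNNSimple.

(** * Density *)

Section density.
Variables (R : realType) (n : nat).
Local Notation RT := (measurableTypeR R).
Local Notation mu := (cube_measure R n).
Local Notation J := (option (freq n + freq n)).
Local Notation V := (near_span (Rsys R n) 0).
Implicit Types (f g : L2 mu) (u v : n.-tuple RT -> R).

Lemma cube_ae (P : n.-tuple RT -> Prop) : (forall x, unit_cube x -> P x) ->
  \forall x \ae mu, P x.
Proof.
move=> h; exists (~` @unit_cube R n); split.
- by apply: measurableC; exact: measurable_unit_cube.
- by rewrite /= /mrestr setICl measure0.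
- by move=> x /= nP xc; apply: nP; exact: h.
Qed.

Lemma spanD f g : V f -> V g -> V (f + g).
Proof. by move=> Vf Vg; rewrite -(addr0 0); exact: near_spanD. Qed.

Lemma spanZ a f : V f -> V (a *: f).
Proof. by move=> /(near_spanZ a); rewrite mulr0. Qed.

Lemma span_sum (I : Type) (r : seq I) (F : I -> L2 mu) :
  (forall i, V (F i)) -> V (\sum_(i <- r) F i).
Proof.
move=> VF; elim: r => [|i r IH]; last by rewrite big_cons; exact: spanD.
by rewrite big_nil -(scale0r (Rsys R n None)); apply: spanZ; exact: near_span_phi.
Qed.

Lemma span_ae f g : (forall x, unit_cube x -> f x = g x) -> V f -> V g.
Proof.
move=> fg Vf; apply: near_span_lim => e e0; exists f => //.
rewrite L2norm_ae0//; apply: cube_ae => x xc.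
by rewrite -[LHS]/(g x - f x) fg// subrr.
Qed.

(** * Functions that represent elements of the closed span on the cube *)

(** Working with plain functions postpones square-integrability and ignores values outside the
    cube. *)
Definition fspan u := exists2 f : L2 mu, V f & forall x, unit_cube x -> f x = u x.

Lemma fspan_span f : fspan f -> V f.
Proof. by move=> [g Vg gf]; apply: span_ae Vg. Qed.

Lemma span_fspan f : V f -> fspan f. Proof. by exists f. Qed.

Lemma eq_fspan u v : (forall x, unit_cube x -> u x = v x) -> fspan u -> fspan v.
Proof. by move=> uv [f Vf fu]; exists f => // x xc; rewrite fu// uv. Qed.

Lemma fspanD u v : fspan u -> fspan v -> fspan (fun x => u x + v x).
Proof.
move=> [f Vf fu] [g Vg gv]; exists (f + g); first exact: spanD.
by move=> x xc; rewrite -fu// -gv.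
Qed.

Lemma fspanZ a u : fspan u -> fspan (fun x => a * u x).
Proof.
move=> [f Vf fu]; exists (a *: f); first exact: spanZ.
by move=> x xc; rewrite -fu.
Qed.

Lemma fspan_cst a : fspan (cst a).
Proof.
exists (a *: Rsys R n None); first exact/spanZ/near_span_phi.
by move=> x _; rewrite -[LHS]/(a * 1) mulr1.
Qed.

Definition bL2 u (mu_ : measurable_fun setT u) c (uc : forall x, `|u x| <= c) : L2 mu :=
  Lfun_Sub (lee1n 2) (L2_bounded mu_ (cube_measure_lty R n) uc).

Lemma fspan_lim (u_ : nat -> n.-tuple RT -> R) u c :
  (forall N, fspan (u_ N)) -> measurable_fun setT u -> (forall x, `|u x| <= c) ->
  (forall N x, unit_cube x -> `|u_ N x| <= c) ->
  (forall x, unit_cube x -> u_ ^~ x @ \oo --> u x) -> fspan u.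
Proof.
move=> Vu mu_ uc u_c u_u; exists (bL2 mu_ uc) => //.
have /choice[f_ hf] : forall N, exists f : L2 mu, V f /\ forall x, unit_cube x -> f x = u_ N x.
  by move=> N; have [f Vf fu] := Vu N; exists f.
have gE x : (c *: Rsys R n None : L2 mu) x = c by rewrite -[LHS]/(c * 1) mulr1.
have := @L2_dominated _ _ _ mu f_ (bL2 mu_ uc) (c *: Rsys R n None).
move=> /(_ _ _ _)/cvgrPdist_lt h; apply: near_span_lim => e e0.
have [|||N _ /(_ N (leqnn _))/=] := h _ _ _ e e0.
- by apply: cube_ae => x xc N; rewrite (hf N).2// gE u_c.
- by apply: nearW => x; rewrite gE; exact: uc.
- apply: cube_ae => x xc; under eq_fun do rewrite (hf _).2//.
  exact: u_u.
rewrite sub0r normrN ger0_norm ?L2norm_ge0// => fe.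
by exists (f_ N) => //; exact: (hf N).1.
Qed.

Section multiplication.
Variables (u : n.-tuple RT -> R) (c : R).
Hypotheses (mu_ : measurable_fun setT u) (uc : forall x, `|u x| <= c).

Lemma bounded_mul_Lfun f : (fun x => u x * f x) \in Lfun mu 2%:E.
Proof.
apply: Lfun2P; first by apply: measurable_funM => //; exact: L2_measurable.
apply: (@le_lt_trans _ _ ((L2norm (c *: f) ^+ 2)%:E)); last exact: ltry.
rewrite L2norm_sqE; apply: ge0_le_integral => //.
- by move=> x _; rewrite lee_fin sqr_ge0.
- apply/measurable_EFinP/measurable_funX/measurable_funM => //; exact: L2_measurable.
- apply/measurable_EFinP/measurable_funX; exact: L2_measurable.
- move=> x _; rewrite lee_fin -[(c *: f : L2 mu) x]/(c * f x) !exprMn.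
  rewrite ler_wpM2r ?sqr_ge0// -[leLHS]real_normK ?num_real//.
  by rewrite lerXn2r ?nnegrE// (le_trans _ (uc x)).
Qed.

Definition bounded_mul f : L2 mu := Lfun_Sub (lee1n 2) (bounded_mul_Lfun f).

Lemma bounded_mul_sum (I : Type) (r : seq I) (a : I -> R) (F : I -> L2 mu) :
  bounded_mul (\sum_(i <- r) a i *: F i) = \sum_(i <- r) a i *: bounded_mul (F i).
Proof.
apply/LfuneqP => x; rewrite L2_sumE -[LHS]/(u x * _) L2_sumE mulr_sumr.
apply: eq_bigr => i _.
by rewrite -[LHS]/(u x * (a i * F i x)) -[RHS]/(a i * (u x * F i x)) mulrCA.
Qed.

Lemma bounded_mulZ a f : bounded_mul (a *: f) = a *: bounded_mul f.
Proof.
apply/LfuneqP => x.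
by rewrite -[LHS]/(u x * (a * f x)) -[RHS]/(a * (u x * f x)) mulrCA.
Qed.

Lemma span_bounded_mul_lim f :
  (forall e, 0 < e -> exists2 g, L2norm (f - g) < e & V (bounded_mul g)) ->
  V (bounded_mul f).
Proof.
move=> h; apply: near_span_lim => e e0.
have c0 : 0 < `|c| + 1 by rewrite ltr_wpDl.
have [g fg Vg] := h _ (divr_gt0 e0 c0).
exists (bounded_mul g) => //.
apply: (@le_lt_trans _ _ (L2norm ((`|c| + 1) *: (f - g)))); last first.
  by rewrite L2normZ gtr0_norm// mulrC -ltr_pdivlMr.
apply: le_L2norm => x.
rewrite -[X in `|X| <= _]/(u x * f x - u x * g x) -mulrBr.
rewrite -[X in _ <= `|X|]/((`|c| + 1) * (f x - g x)) !normrM ler_wpM2r//.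
rewrite (le_trans (uc x))// (ger0_norm (ltW c0)) (le_trans (ler_norm _))// lerDl//.
Qed.

(** Multiplication by a bounded function is continuous, and the elements of the system are limits of
    combinations of harmonics; so products with harmonics decide. *)
Lemma span_bounded_mul f : (forall i j, V (bounded_mul (harm R i j))) ->
  V f -> V (bounded_mul f).
Proof.
move=> Vh Vf; have Vphi j : V (bounded_mul (Rsys R n j)).
  apply: span_bounded_mul_lim => e e0.
  move/cvgrPdist_lt : (@harm_sum_cvg R n j) => /(_ _ e0)[M _ /(_ M (leqnn _))/=].
  rewrite sub0r normrN ger0_norm ?L2norm_ge0// => h.
  exists (cR R *: \sum_(i < M.+1) wR R i *: harm R i j) => //.
  rewrite bounded_mulZ bounded_mul_sum; apply/spanZ/span_sum => i.
  exact: spanZ.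
apply: span_bounded_mul_lim => e e0; have [F [a]] := Vf e e0; rewrite add0r => h.
exists (comb (Rsys R n) a F) => //.
by rewrite /comb bounded_mul_sum; apply: span_sum => j; exact: spanZ.
Qed.

End multiplication.

(** The addition formula splits off the phase [a] into a cosine and a sine wave. Evenness of the
    cosine exchanges [k] for [- k] when the first nonzero entry is negative; the zero frequency
    gives a constant. *)
Lemma fspan_trig a (k : 'I_n -> int) : fspan (fun x => cos (a + pi *+ 2 * phase k x)).
Proof.
have s2 : Num.sqrt 2 != 0 :> R by rewrite sqrtr_eq0 -ltNge.
have pos (l : n.-tuple int) b : lex_pos l ->
    fspan (fun x => cos (b + pi *+ 2 * phase (tnth l) x)).
  move=> l0; pose fl : freq n := @exist _ (fun k : n.-tuple int => lex_pos k) _ l0.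
  have h1 := fspanZ (cos b / Num.sqrt 2) (span_fspan (harm0_span (Some (inl fl)))).
  have h2 := fspanZ (- sin b / Num.sqrt 2) (span_fspan (harm0_span (Some (inr fl)))).
  apply: eq_fspan (fspanD h1 h2) => x _.
  rewrite -[X in _ * X + _]/(Num.sqrt 2 * wave 0 l 0 x).
  rewrite -[X in _ + _ * X]/(Num.sqrt 2 * wave 0 l (pi / 2) x).
  rewrite /wave !mul1r subr0 cosBpihalf !mulrA !divfK//.
  by rewrite mulNr cosD dotzE (mulrC _ (phase _ x)).
have [k0|k0] := pselect (exists i, k i != 0); last first.
  apply: eq_fspan (fspan_cst (cos a)) => x _; rewrite /phase big1 ?mulr0 ?addr0// => i _.
  suff -> : k i = 0 by rewrite mul0r.
  by apply/eqP/negPn/negP => ki; apply: k0; exists i.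
have [i ki kmin] : exists2 i, k i != 0 & forall j : 'I_n, (j < i)%N -> k j = 0.
  have [i0 ki0] := k0.
  case: (@arg_minnP _ i0 (fun i => k i != 0) (fun i : 'I_n => i : nat) ki0) => i ki im.
  exists i => // j ji; apply/eqP/negPn/negP => kj.
  by have := im j kj; rewrite leqNgt ji.
have [kp|kn] := ltP 0 (k i).
  have l0 : lex_pos [tuple k j | j < n].
    apply/existsP; exists i; rewrite tnth_mktuple kp/=; apply/forallP => j.
    by rewrite tnth_mktuple; apply/implyP => /kmin ->.
  apply: eq_fspan (pos _ a l0) => x _; congr (cos (_ + _ * _)).
  by apply: eq_bigr => j _; rewrite tnth_mktuple.
have l0 : lex_pos [tuple - k j | j < n].
  apply/existsP; exists i; rewrite tnth_mktuple oppr_gt0 lt_neqAle ki kn/=; apply/forallP => j.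
  by rewrite tnth_mktuple; apply/implyP => /kmin ->; rewrite oppr0.
apply: eq_fspan (pos _ (- a) l0) => x _; rewrite -cosN opprD opprK -mulrN.
congr (cos (_ + _ * _)); rewrite -sumrN; apply: eq_bigr => j _.
by rewrite tnth_mktuple intrN mulNr opprK.
Qed.

Lemma fspan_trigM a a' (k k' : 'I_n -> int) :
  fspan (fun x => cos (a + pi *+ 2 * phase k x) * cos (a' + pi *+ 2 * phase k' x)).
Proof.
have h := fspanD (fspan_trig (a - a') (fun i => k i - k' i))
                 (fspan_trig (a + a') (fun i => k i + k' i)).
apply: eq_fspan (fspanZ 2^-1 h) => x _.
have -> : phase (fun i => k i - k' i) x = phase k x - phase k' x.
  by rewrite /phase -sumrB; apply: eq_bigr => j _; rewrite intrD mulrDl intrN mulNr.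
have -> : phase (fun i => k i + k' i) x = phase k x + phase k' x.
  by rewrite /phase -big_split; apply: eq_bigr => j _; rewrite intrD mulrDl.
move: (phase k x) (phase k' x) => p q.
have -> : a - a' + pi *+ 2 * (p - q) = (a + pi *+ 2 * p) - (a' + pi *+ 2 * q) by ring.
have -> : a + a' + pi *+ 2 * (p + q) = (a + pi *+ 2 * p) + (a' + pi *+ 2 * q) by ring.
move: (a + pi *+ 2 * p) (a' + pi *+ 2 * q) => A B.
by rewrite cosB cosD; field.
Qed.

Lemma fspan_mul_harm u i j :
  (forall a k, fspan (fun x => u x * cos (a + pi *+ 2 * phase k x))) ->
  fspan (fun x => u x * harm R i j x).
Proof.
pose m := (i.*2).+1; move=> h; case: j => [[k|k]|].
- apply: eq_fspan (fspanZ (Num.sqrt 2) (h (- (m%:R * 0)) (fun j => m%:Z * tnth (val k) j))) => x _.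
  by rewrite mulrCA -waveE.
- apply: eq_fspan (fspanZ (Num.sqrt 2) (h (- (m%:R * (pi / 2))) (fun j => m%:Z * tnth (val k) j))) => x _.
  by rewrite mulrCA -waveE.
- apply: eq_fspan (fspanZ (if i == 0%N then 1 else lamR R) (h 0 (fun=> 0))) => x _.
  rewrite /phase big1 ?mulr0 ?addr0 ?cos0 ?mulr1; last by move=> l _; rewrite mul0r.
  by rewrite mulrC.
Qed.

Lemma fspan_trig_mul a k f : V f -> fspan (fun x => cos (a + pi *+ 2 * phase k x) * f x).
Proof.
move=> Vf; have cb x : `|cos (a + pi *+ 2 * phase k x)| <= 1 :> R by exact: cos_max.
exists (bounded_mul (measurable_cos_phase a k) cb f) => //.
apply: span_bounded_mul => // i j; apply: fspan_span.
by apply: fspan_mul_harm => a' k'; exact: fspan_trigM.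
Qed.

(** Second pass: [u] times a trigonometric function is already known to stay in the closed span,
    since [u] lies in it; boundedness of [u] then extends this from the harmonics to [v]. *)
Lemma fspanM u v c : measurable_fun setT u -> (forall x, `|u x| <= c) ->
  fspan u -> fspan v -> fspan (fun x => u x * v x).
Proof.
move=> mu_ uc [g Vg gu] [f Vf fv].
exists (bounded_mul mu_ uc f); last by move=> x xc; rewrite -fv.
apply: span_bounded_mul => // i j; apply: fspan_span.
apply: fspan_mul_harm => a k; apply: eq_fspan (fspan_trig_mul a k Vg) => x xc.
by rewrite mulrC gu.
Qed.

(** * The sigma-algebra of sets with indicator function in the closed span *)

Definition spanset (A : set (n.-tuple RT)) := measurable A /\ fspan (\1_A).

Lemma indic_bound (A : set (n.-tuple RT)) x : `|\1_A x : R| <= 1.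
Proof. by rewrite indicE; case: (_ \in _); rewrite ?normr0 ?normr1. Qed.

Lemma spansetC A : spanset A -> spanset (~` A).
Proof.
move=> [mA VA]; split; first exact: measurableC.
apply: eq_fspan (fspanD (fspan_cst 1) (fspanZ (-1) VA)) => x _.
by rewrite !indicE in_setC mulN1r; case: (_ \in _); rewrite ?subrr ?subr0.
Qed.

Lemma spansetI A B : spanset A -> spanset B -> spanset (A `&` B).
Proof.
move=> [mA VA] [mB VB]; split; first exact: measurableI.
have := @fspanM \1_A \1_B 1 (measurable_indic mA) (@indic_bound A) VA VB.
by apply: eq_fspan => x _; rewrite indicI.
Qed.

Lemma spansetU A B : spanset A -> spanset B -> spanset (A `|` B).
Proof.
by move=> sA sB; rewrite -[A `|` B]setCK setCU; apply/spansetC/spansetI; exact: spansetC.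
Qed.

Lemma spanset0 : spanset set0.
Proof. by split=> //; apply: eq_fspan (fspan_cst 0) => x _; rewrite indic0. Qed.

Lemma spanset_bigcup (A : nat -> set (n.-tuple RT)) :
  (forall N, spanset (A N)) -> spanset (\bigcup_N A N).
Proof.
move=> sA; have sU N : spanset (\big[setU/set0]_(i < N) A i).
  by elim: N => [|N IH]; rewrite ?big_ord0 ?big_ord_recr/=; [exact: spanset0|exact: spansetU].
split; first by apply: bigcupT_measurable => N; have [] := sA N.
have mU : measurable (\bigcup_N A N).
  by apply: bigcupT_measurable => N; have [] := sA N.
apply: (@fspan_lim (fun N => \1_(\big[setU/set0]_(i < N) A i)) _ 1).
- by move=> N; have [] := sU N.
- exact: measurable_indic.
- exact: indic_bound.
- by move=> N x _; exact: indic_bound.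
move=> x _; rewrite indicE; have [|xn] := boolP (x \in _).
  rewrite inE => -[N _ AN]; apply: cvg_near_cst; exists N.+1 => // M /= NM.
  rewrite indicE mem_set// -bigcup_mkord; by exists N.
apply: cvg_near_cst; apply: nearW => M; rewrite indicE memNset// -bigcup_mkord => -[i _ Ai].
by move/negP : xn; apply; rewrite inE; exists i.
Qed.

Lemma spanset_cube A B : measurable B -> (forall x, unit_cube x -> A x <-> B x) ->
  spanset A -> spanset B.
Proof.
move=> mB AB [mA VA]; split => //; apply: eq_fspan VA => x xc.
by rewrite !indicE; congr (_%:R); congr nat_of_bool; apply/idP/idP; rewrite !inE AB.
Qed.

Lemma fspan_sum (I : Type) (r : seq I) (u_ : I -> n.-tuple RT -> R) :
  (forall i, fspan (u_ i)) -> fspan (fun x => \sum_(i <- r) u_ i x).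
Proof.
move=> h; elim: r => [|i r IH].
  by apply: eq_fspan (fspan_cst 0) => x _; rewrite big_nil.
by apply: eq_fspan (fspanD (h i) IH) => x _; rewrite big_cons.
Qed.

(** Both sides are limits of the same cosine sums, which avoids computing with the floor
    function. *)
Lemma tri_cosE (y : R) : -1 <= y <= 1 -> tri_cos y = 4 * `| `|y| - 1 / 2| - 1.
Proof.
move=> y1; apply/eqP; rewrite -subr_eq0 -normr_le0.
apply: (@le_forall_divn _ _ _ 2) => N N0; rewrite add0r.
have h1 := tri_cos_expansion y N0; have h2 := triangle_wave_expansion N0 y1.
move: h1 h2; set z := 8 / _ * _; set t := _ - 1 => h1 h2.
have -> : tri_cos y - t = (tri_cos y - z) - (t - z) by ring.
apply: (le_trans (ler_normB _ _)).
by rewrite mulr_natl mulr2n lerD.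
Qed.

(** * Half-spaces *)

Section coordinate.
Variable i0 : 'I_n.

Lemma phase_coordinate (m : int) (x : n.-tuple RT) :
  phase (fun i => if i == i0 then m else 0) x = m%:~R * tnth x i0.
Proof.
rewrite /phase (bigD1 i0)//= eqxx big1 ?addr0// => i /negPf->.
by rewrite mul0r.
Qed.

(** A translate by a real [b] is not itself in the system, but it is a uniform limit of
    trigonometric functions with shifted phases. *)
Lemma fspan_tri_cos b : fspan (fun x => tri_cos (tnth x i0 - b)).
Proof.
pose z (x : n.-tuple RT) : R := tnth x i0 - b.
have mz : measurable_fun setT z by apply: measurable_funB => //; exact: measurable_tnth.
apply: (@fspan_lim (fun N x => 8 / pi ^+ 2 * cos_partial N.+1 (z x * (pi *+ 2))) _ 2).
- move=> N; apply: fspanZ;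
  apply: (@fspan_sum _ (index_enum 'I_N.+1)
    (fun i x => cos ((i.*2).+1%:R * (z x * (pi *+ 2))) / (i.*2).+1%:R ^+ 2)) => i.
  pose m := (i.*2).+1.
  have := fspanZ (m%:R ^- 2) (fspan_trig (- (m%:R * b * (pi *+ 2)))
    (fun j => if j == i0 then m%:Z else 0)).
  apply: eq_fspan => x _; rewrite phase_coordinate mulrC; congr (cos _ / _).
  rewrite -/m /z -[m%:~R]/(m%:R).
  by move: (m%:R) (tnth x i0) (pi *+ 2) => A B C; ring.
- exact: (measurableT_comp (@measurable_tri_cos R) mz).
- by move=> x; apply: (le_trans (tri_cos_le1 _)); rewrite ler1n.
- move=> N x _; cbv beta.
  have := tri_cos_expansion (z x) (ltn0Sn N); have := tri_cos_le1 (z x).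
  have : N.+1%:R^-1 <= 1 :> R by rewrite invf_le1 ?ltr0n// ler1n.
  set w := 8 / _ * _; move: (N.+1%:R^-1) => t; rewrite !ler_norml => h /andP[? ?] /andP[? ?].
  by apply/andP; split; lra.
- move=> x _; apply/cvgrPdist_lt => e e0.
  have := @cvg_harmonic R; move/cvgrPdist_lt => /(_ _ e0); apply: filterS => N.
  rewrite sub0r normrN ger0_norm ?invr_ge0//; apply: le_lt_trans.
  exact: tri_cos_expansion.
Qed.

(* The difference quotients of the triangular wave converge to a square wave. *)
Lemma spanset_half b : 0 <= b <= 1 / 2 ->
  spanset [set x | b < tnth x i0 <= b + 1 / 2].
Proof.
move=> /andP[b0 b1]; set E := [set x | _].
have mE : measurable E.
  rewrite (_ : E = (@tnth n RT ^~ i0) @^-1` `]b, b + 1 / 2]); last first.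
    by apply/seteqP; split => x /=; rewrite in_itv.
  by rewrite -[X in measurable X]setTI; exact: measurable_tnth.
pose u : n.-tuple RT -> R := fun x => 8 * \1_E x - 4.
suff Vu : fspan u.
  split => //; apply: eq_fspan (fspanZ 8^-1 (fspanD Vu (fspan_cst 4))) => x _.
  by rewrite /u /= subrK mulrA mulVf// mul1r.
(* Steps of at most [1/2] keep [b + h N <= 1], so the shifted coordinates stay in [[-1, 1]], where
   [tri_cosE] applies. *)
pose h N : R := N.+2%:R^-1.
have h0 N : 0 < h N by rewrite invr_gt0 ltr0n.
have h1 N : h N <= 1 / 2 by rewrite div1r lef_pV2 ?posrE ?ltr0n// ler_nat.
have hE N : N.+2%:R = (h N)^-1 by rewrite invrK.
apply: (@fspan_lim (fun N x => N.+2%:R * (tri_cos (tnth x i0 - (b + h N)) -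
  tri_cos (tnth x i0 - b))) _ 4).
- move=> N; apply: fspanZ.
  apply: eq_fspan (fspanD (fspan_tri_cos (b + h N)) (fspanZ (-1) (fspan_tri_cos b))) => x _.
  by rewrite mulN1r.
- by apply: measurable_funB => //; apply: measurable_funM => //; exact: measurable_indic.
- move=> x; rewrite /u indicE; case: (x \in E) => /=; rewrite ler_norml; apply/andP; split; lra.
- move=> N x xc; have /andP[x0 x1] := xc i0; have := h0 N; have := h1 N => hN1 hN0.
  rewrite !tri_cosE; [|by apply/andP; split; lra..].
  rewrite normrM gtr0_norm ?ltr0n// hE mulrC ler_pdivrMr//.
  set y := tnth x i0 - b.
  have -> : tnth x i0 - (b + h N) = y - h N by rewrite /y; ring.
  set p := `| `|y - h N| - 1 / 2|; set q := `| `|y| - 1 / 2|.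
  have -> : 4 * p - 1 - (4 * q - 1) = 4 * (p - q) by ring.
  rewrite normrM ger0_norm// ler_pM2l// /p /q (le_trans (ler_dist_dist _ _))//.
  have -> : `|y - h N| - 1 / 2 - (`|y| - 1 / 2) = `|y - h N| - `|y| by ring.
  rewrite (le_trans (ler_dist_dist _ _))// addrAC subrr add0r normrN gtr0_norm//.
- move=> x xc; have /andP[x0 x1] := xc i0.
  set y := tnth x i0 - b.
  have small d : 0 < d -> \forall N \near \oo, h N <= d.
    move=> d0; have := @cvg_harmonic R; move/cvgrPdist_lt => /(_ _ d0).
    apply: filterS => N; rewrite sub0r normrN ger0_norm ?invr_ge0// => /ltW.
    by apply: le_trans; rewrite lef_pV2 ?posrE ?ltr0n// ler_nat.
  (* Here [d] will be the distance from [y] to the next kink on its left, at [-1/2], [0] or [1/2];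
     for steps up to [d] the quotient is constant. The quotients look to the left, hence the
     intervals closed on the right. *)
  have key d s : 0 < d -> (forall N, h N <= d ->
      4 * `| `|y - h N| - 1 / 2| - (4 * `| `|y| - 1 / 2|) = s * h N) -> u x = s ->
      (fun N => N.+2%:R * (tri_cos (tnth x i0 - (b + h N)) - tri_cos (tnth x i0 - b)))
       @ \oo --> u x.
    move=> d0 hs ->; apply: cvg_near_cst; apply: filterS (small _ d0) => N hNd.
    have := h0 N; have := h1 N => hN1 hN0.
    rewrite !tri_cosE; [|by apply/andP; split; lra..].
    have -> : tnth x i0 - (b + h N) = y - h N by rewrite /y; ring.
    rewrite -/y -(_ : s * h N / h N = s); last by rewrite mulfK// gt_eqF.
    rewrite -hs// hE mulrC; congr (_ / _); ring.
  have uE : u x = if 0 < y <= 1 / 2 then 4 else -4.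
    rewrite /u indicE; case: ifPn => yb.
      rewrite mem_set/=; first by lra.
      by move: yb; rewrite /y => /andP[? ?]; apply/andP; split; lra.
    rewrite memNset/=; first by lra.
    by move=> /= /andP[? ?]; move/negP: yb; apply; apply/andP; rewrite /y; split; lra.
  have [y0|y0] := leP y 0.
    apply: (@key (1 / 2 + y) (-4)); [by rewrite /y; lra| |by rewrite uE ltNge y0].
    move=> N hN; have := h0 N => hN0.
    rewrite (ler0_norm y0) (@ler0_norm _ (y - h N)); last by lra.
    by rewrite !ler0_norm; [ring|lra..].
  have [y2|y2] := leP y (1 / 2).
    apply: (@key y 4) => //; last by rewrite uE y0 y2.
    move=> N hN; have := h0 N => hN0.
    rewrite (gtr0_norm y0) (@ger0_norm _ (y - h N)); last by lra.
    by rewrite !ler0_norm; [ring|lra..].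
  apply: (@key (y - 1 / 2) (-4)); [by lra| |by rewrite uE (leNgt y) y2 andbF].
  move=> N hN; have := h0 N => hN0.
  rewrite (gtr0_norm y0) (@ger0_norm _ (y - h N)); last by lra.
  by rewrite !ger0_norm; [ring|lra..].
Qed.

(** Within the cube, the complement [x <= a] is []0, 1/2]] minus []a, a + 1/2]] if [0 <= a <= 1/2],
    and the union of []0, 1/2]] and []a - 1/2, a]] if [1/2 < a <= 1]. *)
Lemma spanset_ray a : spanset ((@tnth n RT ^~ i0) @^-1` `]a, +oo[).
Proof.
have mR : measurable ((@tnth n RT ^~ i0) @^-1` `]a, +oo[).
  by rewrite -[X in measurable X]setTI; exact: measurable_tnth.
have s0 : spanset [set x | 0 < tnth x i0 <= 0 + 1 / 2] by apply: spanset_half; lra.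
have [a0|a0] := ltP a 0.
  apply: (spanset_cube mR _ (spansetC spanset0)) => x /(_ i0)/andP[x0 x1] /=.
  by rewrite in_itv/= andbT; split=> // _; lra.
have [a1|a1] := ltP 1 a.
  apply: (spanset_cube mR _ spanset0) => x /(_ i0)/andP[x0 x1] /=.
  by rewrite in_itv/= andbT; split=> // h; lra.
have [a2|a2] := leP a (1 / 2).
  have sa : spanset [set x | a < tnth x i0 <= a + 1 / 2] by apply: spanset_half; rewrite a0.
  apply: (spanset_cube mR _ (spansetC (spansetI s0 (spansetC sa)))).
  move=> x /(_ i0)/andP[x0 x1] /=; rewrite in_itv/= andbT; split.
    move=> h; rewrite ltNge; apply/negP => xa; apply: h; split.
      by apply/andP; split; lra.
    by move=> /andP[? ?]; lra.
  by move=> xa [/andP[? ?]]; apply; apply/andP; split; lra.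
have sa : spanset [set x | a - 1 / 2 < tnth x i0 <= a - 1 / 2 + 1 / 2].
  by apply: spanset_half; apply/andP; split; lra.
apply: (spanset_cube mR _ (spansetC (spansetU s0 sa))).
move=> x /(_ i0)/andP[x0 x1] /=; rewrite in_itv/= andbT; split.
  move=> h; rewrite ltNge; apply/negP => xa; apply: h.
  have [xh|xh] := leP (tnth x i0) (1 / 2); [left|right].
    by apply/andP; split; lra.
  by apply/andP; split; lra.
by move=> xa [] /andP[? ?]; lra.
Qed.

Lemma spanset_preimage (B : set RT) : measurable B -> spanset ((@tnth n RT ^~ i0) @^-1` B).
Proof.
rewrite RGenOInfty.measurableE.
pose P : set (set RT) := [set C | spanset ((@tnth n RT ^~ i0) @^-1` C)].
suff : <<s @RGenOInfty.G R >> `<=` P by exact.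
apply: smallest_sub.
  split.
  - by rewrite /P /= preimage_set0; exact: spanset0.
  - by move=> A sA; rewrite /P /= setTD preimage_setC; exact: spansetC.
  - by move=> A sA; rewrite /P /= preimage_bigcup; exact: spanset_bigcup.
by move=> _ [a ->]; exact: spanset_ray.
Qed.

End coordinate.

Lemma spanset_measurable (A : set (n.-tuple RT)) : measurable A -> spanset A.
Proof.
apply: smallest_sub.
  split.
  - exact: spanset0.
  - by move=> B sB; rewrite setTD; exact: spansetC.
  - by move=> B sB; exact: spanset_bigcup.
rewrite -bigcup_seq => _ [i _ [B mB <-]]; rewrite setTI.
exact: spanset_preimage.
Qed.

(** * From simple functions to the whole space *)

Lemma fspan_nnsfun (h : {nnsfun n.-tuple RT >-> R}) : fspan h.
Proof.
apply: (@eq_fspan (fun x => \sum_(y <- fset_set (range h)) y * \1_(h @^-1` [set y]) x)).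
  by move=> x _; rewrite [RHS]fimfunE fsbig_finite.
apply: (@fspan_sum _ _ (fun y x => y * \1_(h @^-1` [set y]) x)) => y.
by apply: fspanZ; apply: (spanset_measurable _).2.
Qed.

(** The simple functions increasing to [f] are dominated by [f] itself, so dominated convergence
    covers unbounded [f]. *)
Lemma span_ge0 f : (forall x, 0 <= f x) -> V f.
Proof.
move=> f0; have mf : measurable_fun setT (EFin \o f).
  by apply/measurable_EFinP; exact: L2_measurable.
pose h N := nnsfun_approx measurableT mf N.
have hf x : (h N x) @[N --> \oo] --> f x.
  have /fine_cvgP[_] := @cvg_nnsfun_approx _ _ _ _ measurableT _ mf (fun x _ => f0 x) x I.
  exact.
have hle N x : h N x <= f x.
  have nd := nd_nnsfun_approx measurableT mf.
  rewrite -(cvg_lim (@Rhausdorff R) (hf x)).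
  apply: nondecreasing_cvgn_le; last by apply/cvg_ex; exists (f x); exact: hf.
  by move=> k l kl; have /lefP := nd k l kl; exact.
have /choice[f_ f_h] : forall N, exists g : L2 mu, V g /\ forall x, unit_cube x -> g x = h N x.
  by move=> N; have [g Vg gh] := fspan_nnsfun (h N); exists g.
apply: near_span_lim => e e0.
have := @L2_dominated _ _ _ mu f_ f f.
move=> /(_ _ _ _)/cvgrPdist_lt cv.
have [|||N _ /(_ N (leqnn _))/=] := cv _ _ _ e e0.
- by apply: cube_ae => x xc N; rewrite (f_h N).2// ger0_norm.
- by apply: nearW => x; rewrite ger0_norm.
- by apply: cube_ae => x xc; under eq_fun do rewrite (f_h _).2//; exact: hf.
rewrite sub0r normrN ger0_norm ?L2norm_ge0// => fe.
by exists (f_ N) => //; exact: (f_h N).1.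
Qed.

Lemma span_all f : V f.
Proof.
pose A := [set x | 0 <= f x].
have mf : measurable_fun setT f := L2_measurable f.
have mA : measurable A.
  rewrite (_ : A = f @^-1` `[0, +oo[); last by apply/seteqP; split => x /=; rewrite in_itv/= andbT.
  by rewrite -[X in measurable X]setTI; exact: mf.
have mAC := measurableC mA.
pose g1 := bounded_mul (measurable_indic mA) (@indic_bound A) f.
pose g2 := bounded_mul (measurable_indic mAC) (@indic_bound (~` A)) (- f).
have -> : f = g1 + (-1) *: g2.
  apply/LfuneqP => x; rewrite -[RHS]/(\1_A x * f x + -1 * (\1_(~` A) x * - f x)).
  by rewrite !indicE in_setC; case: (_ \in _) => /=; ring.
apply: spanD; last apply: spanZ.
  apply: span_ge0 => x; rewrite -[leRHS]/(\1_A x * f x) indicE.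
  by have [|] := boolP (x \in A); rewrite ?mul0r// inE mul1r.
apply: span_ge0 => x; rewrite -[leRHS]/(\1_(~` A) x * - f x) indicE in_setC.
have [|xA] := boolP (x \in A); rewrite ?mul0r// mul1r oppr_ge0.
by move/negP: xA; rewrite inE /A /= => /negP; rewrite -ltNge => /ltW.
Qed.

End density.

Theorem theorem3p10 (R : realType) (n : nat) (n_ge1 : (1 <= n)%N) :
  let A : R := ((4 * Num.sqrt 6 / pi ^+ 2) * (2 - pi ^+ 2 / 8)) ^+ 2 in
  let B : R := 3 / 2 in
  riesz_basis (cube_measure R n) (Rsys R n) A B /\
  5787 / 10000 <= A < 5788 / 10000.
Proof.
move=> A B.
have Abd : 5787 / 10000 <= A < 5788 / 10000 := riesz_lower_bounds R.
have AE : A = (cR R * (1 - qR R)) ^+ 2 by rewrite /A /cR /qR opprB addrA.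
split=> //; move: A AE Abd => A AE /andP[A1 A2].
split.
- by clear AE; split; rewrite /B; lra.
- move=> alpha S Soo; apply: riesz_sum => //; first by rewrite /B divr_ge0.
  by move=> F beta; rewrite AE; exact: Rsys_bounds.
- move=> f eps eps0; have [F [alpha h]] := span_all f eps0.
  by exists F, alpha; move: h; rewrite add0r.
Qed.
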